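(* Let $G$ be a second countable locally compact group, $(\pi,\mathcal H_\pi)$ a projective unitary representation of $G$, $\Lambda\subseteq G$ a Delone set and $\nu$ an invariant Radon probability measure on $\Omega(\Lambda)$. If $\{\pi(\lambda)\psi\}_{\lambda\in\Lambda}$ is a Bessel sequence in $\mathcal H_\pi$ for some $\psi\in\mathcal H_\pi$ with Bessel bound $C_2>0$, then $$\frac{\|C_\psi f\|_{L^2(G)}^2}{\|f\|^2\,\mathrm{covol}_\nu(\Lambda)}\le C_2\quad\text{for all } f\in\mathcal H_\pi\setminus\{0\}.$$ If in addition $\psi\in\mathcal B_\pi$ and $\{\pi(\lambda)\psi\}_{\lambda\in\Lambda}$ has a lower frame bound $C_1>0$, then $$\frac{\|C_\psi f\|_{L^2(G)}^2}{\|f\|^2\,\mathrm{covol}_\nu(\Lambda)}\ge C_1\quad\text{for all } f\in\mathcal H_\pi\setminus\{0\}.$$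
   Context: $G$ is a second countable locally compact group with identity $e_G$ and a fixed left Haar measure $\mu_G$; $L^2(G)$ is with respect to $\mu_G$. A projective unitary representation $(\pi,\mathcal H_\pi)$ is a strongly measurable $\pi:G\to\mathcal U(\mathcal H_\pi)$ with $\pi(e_G)=I$ and $\pi(g_1)\pi(g_2)=\sigma(g_1,g_2)\pi(g_1g_2)$ for some measurable $\sigma:G\times G\to\mathbb T$. $C_\psi f(g)=\langle f,\pi(g)\psi\rangle$. For a fixed compact neighborhood $Q$ of $e_G$, $MF(g)=\sup_{q\in Q}|F(gq)|$, $W(L^2)=\{F\in L^\infty_{loc}(G): MF\in L^2(G)\}$, $\mathcal B_\pi=\{\psi\in\mathcal H_\pi: C_\psi f\in W(L^2)\ \forall f\in\mathcal H_\pi\}$. For $S\subseteq G$, $\Lambda$ is $S$-separated if $\#(\Lambda\cap gS)\le1$ for all $g$, $S$-dense if $\#(\Lambda\cap gS)\ge1$ for all $g$. Delone set: $U$-separated for some nonempty open $U$ and $K$-dense for some compact $K$. $\mathcal C(G)$: closed subsets of $G$ with the Chabauty–Fell topology (neighborhood basis at $C$: $\mathcal V_{K,U}(C)=\{C': C'\cap K\subseteq CU,\ C\cap K\subseteq C'U\}$, $K$ compact, $U$ open neighborhood of $e_G$); $G$ acts by $C\mapsto xC$; hull $\Omega(\Lambda)=\overline{\{x\Lambda:x\in G\}}$. A Radon probability measure $\nu$ on $\Omega(\Lambda)$ is invariant if $\nu(gB)=\nu(B)$ for all $g\in G$ and measurable $B$. $\mathrm{covol}_\nu(\Lambda)\in(0,\infty)$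 is the constant with $\int_{\Omega(\Lambda)}\sum_{\gamma\in\Gamma}f(\gamma)\,d\nu(\Gamma)=\mathrm{covol}_\nu(\Lambda)^{-1}\int_G f\,d\mu_G$ for all $f\in C_c(G)$. *)

(* Defs.v *)
From HB Require Import structures.
From mathcomp Require Import all_boot all_order all_algebra.
From mathcomp Require Import all_classical all_reals all_analysis measurable_realfun.
From mathcomp Require Import complex.
Unset Printing Implicit Defensive.
Import Order.TTheory GRing.Theory Num.Theory numFieldTopology.Exports numFieldNormedType.Exports.
Local Open Scope classical_set_scope.
Local Open Scope ring_scope.

Definition is_group {G : Type} (mul : G -> G -> G) (inv : G -> G) (e : G) :=
  [/\ forall x y z, mul x (mul y z) = mul (mul x y) z,
      forall x, mul e x = x /\ mul x e = x &
      forall x, mul (inv x) x = e /\ mul x (inv x) = e].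

Definition lcsc_group {G : ptopologicalType} (mul : G -> G -> G) (inv : G -> G)
  (e : G) :=
  [/\ is_group mul inv e,
      continuous (fun p : G * G => mul p.1 p.2) /\ continuous inv,
      hausdorff_space G,
      locally_compact [set: G] &
      @second_countable G].

Definition ltrans {G : Type} (mul : G -> G -> G) (g : G) (S : set G) : set G :=
  [set mul g s | s in S].

Notation borel G := (g_sigma_algebraType (@open G)).

Definition radon {d} {T : measurableType d} {R : realType}
  (opn cpt : set (set T)) (m : set T -> \bar R) :=
  [/\ forall K, cpt K -> (m K < +oo)%E,
      forall B, measurable B ->
        m B = ereal_inf [set m U | U in [set U | opn U /\ B `<=` U]] &
      forall U, opn U ->
        m U = ereal_sup [set m K | K in [set K | cpt K /\ K `<=` U]]].

Definition left_haar {R : realType} {G : ptopologicalType}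
  (mul : G -> G -> G) (mu : set (borel G) -> \bar R) :=
  [/\ forall (x : G) (B : set (borel G)), measurable B ->
        mu (ltrans mul x B) = mu B,
      @radon _ (borel G) R (@open G) (@compact G) mu &
      forall U : set G, open U -> U !=set0 -> (0 < mu U)%E].

Definition hnorm {R : realType} {H : lmodType R[i]} (ip : H -> H -> R[i])
  (f : H) : R := Num.sqrt (complex.Re (ip f f)).

Definition is_hilbert {R : realType} {H : lmodType R[i]} (ip : H -> H -> R[i]) :=
  [/\ forall (a : R[i]) f g h, ip (a *: f + g) h = a * ip f h + ip g h,
      forall f g, ip g f = (ip f g)^*,
      forall f, 0 <= complex.Re (ip f f) /\ complex.Im (ip f f) = 0,
      forall f, ip f f = 0 -> f = 0 &
      forall u : nat -> H,
        (forall eps : R, 0 < eps -> exists N, forall n m, (N <= n)%N -> (N <= m)%N ->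
           hnorm ip (u n - u m) < eps) ->
        exists l, forall eps : R, 0 < eps -> exists N, forall n, (N <= n)%N ->
           hnorm ip (u n - l) < eps].

Definition hopen {R : realType} {H : lmodType R[i]} (ip : H -> H -> R[i])
  (U : set H) :=
  forall x, U x -> exists2 r : R, 0 < r & forall y, hnorm ip (y - x) < r -> U y.

Definition unitary {R : realType} {H : lmodType R[i]} (ip : H -> H -> R[i])
  (T : H -> H) :=
  [/\ forall (a : R[i]) f g, T (a *: f + g) = a *: T f + T g,
      forall f g, ip (T f) (T g) = ip f g &
      forall g, exists f, T f = g].

Definition cmeasurable {d} {T : measurableType d} {R : realType}
  (F : T -> R[i]) :=
  measurable_fun [set: T] (fun x => complex.Re (F x)) /\
  measurable_fun [set: T] (fun x => complex.Im (F x)).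

Definition proj_unitary_rep {R : realType} {G : ptopologicalType}
  (mul : G -> G -> G) (e : G) {H : lmodType R[i]} (ip : H -> H -> R[i])
  (pi : G -> H -> H) :=
  [/\ forall g, unitary ip (pi g),
      forall f : H, forall U, hopen ip U ->
        measurable ((fun g : borel G => pi g f) @^-1` U),
      pi e = id &
      exists sigma : (borel G * borel G)%type -> R[i],
        [/\ cmeasurable sigma,
            forall p, ComplexField.Normc.normc (sigma p) = 1 &
            forall g1 g2 f, pi g1 (pi g2 f) = sigma (g1, g2) *: pi (mul g1 g2) f]].

Definition voice {R : realType} {G : Type} {H : lmodType R[i]}
  (ip : H -> H -> R[i]) (pi : G -> H -> H) (psi f : H) : G -> R[i] :=
  fun g => ip f (pi g psi).

Definition maxfun {R : realType} {G : Type} (mul : G -> G -> G) (Q : set G)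
  (F : G -> R[i]) : G -> \bar R :=
  fun g => ereal_sup [set (ComplexField.Normc.normc (F (mul g q)))%:E | q in Q].

Definition Linfty_loc {R : realType} {G : ptopologicalType}
  (mu : set (borel G) -> \bar R) (F : borel G -> R[i]) :=
  cmeasurable F /\
  forall K : set G, compact K ->
    exists M : R, {ae mu, forall x : borel G, K x -> ComplexField.Normc.normc (F x) <= M}.

Definition amalgam_L2 {R : realType} {G : ptopologicalType}
  (mul : G -> G -> G) (Q : set G)
  (mu : {measure set (borel G) -> \bar R}) (F : borel G -> R[i]) :=
  [/\ Linfty_loc mu F,
      measurable_fun [set: borel G] (maxfun mul Q F : borel G -> \bar R) &
      (\int[mu]_(x in [set: borel G]) (maxfun mul Q F x) ^+ 2 < +oo)%E].

Definition B_space {R : realType} {G : ptopologicalType}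
  (mul : G -> G -> G) (Q : set G)
  (mu : {measure set (borel G) -> \bar R})
  {H : lmodType R[i]} (ip : H -> H -> R[i]) (pi : G -> H -> H) (psi : H) :=
  forall f : H, amalgam_L2 mul Q mu (voice ip pi psi f).

Definition lseparated {G : Type} (mul : G -> G -> G) (S Lam : set G) :=
  forall g a b, Lam a -> ltrans mul g S a -> Lam b -> ltrans mul g S b -> a = b.

Definition dense_in {G : Type} (mul : G -> G -> G) (S Lam : set G) :=
  forall g, exists a, Lam a /\ ltrans mul g S a.

Definition delone {G : ptopologicalType} (mul : G -> G -> G) (Lam : set G) :=
  (exists U : set G, [/\ open U, U !=set0 & lseparated mul U Lam]) /\
  (exists K : set G, compact K /\ dense_in mul K Lam).

(* We work on the carrier type (set G); only closed sets matter.        *)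
Definition CF_nbhd {G : Type} (mul : G -> G -> G) (K U C C' : set G) :=
  (C' `&` K `<=` [set mul c u | c in C & u in U]) /\
  (C `&` K `<=` [set mul c u | c in C' & u in U]).

(* open sets of the Chabauty--Fell topology (membership tested only on
   closed sets; sets of non-closed subsets are irrelevant) *)
Definition CF_open {G : ptopologicalType} (mul : G -> G -> G) (e : G)
  (O : set (set G)) :=
  forall C, closed C -> O C ->
    exists K U : set G, [/\ compact K, open U, U e &
      forall C', closed C' -> CF_nbhd mul K U C C' -> O C'].

Definition CF_compact {G : ptopologicalType} (mul : G -> G -> G) (e : G)
  (Kc : set (set G)) :=
  Kc `<=` [set C | closed C] /\
  forall (I : Type) (O : I -> set (set G)), (forall i, CF_open mul e (O i)) ->
    Kc `<=` \bigcup_i O i ->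
    exists2 J : set I, finite_set J & Kc `<=` \bigcup_(i in J) O i.

Notation CFborel mul e :=
  (g_sigma_algebraType (CF_open mul e)).

Definition hull {G : ptopologicalType} (mul : G -> G -> G) (e : G)
  (Lam : set G) : set (set G) :=
  [set C | closed C /\
     forall K U : set G, compact K -> open U -> U e ->
       exists x, CF_nbhd mul K U C (ltrans mul x Lam)].

Definition inv_radon_prob_on_hull {R : realType} {G : ptopologicalType}
  (mul : G -> G -> G) (e : G) (Lam : set G)
  (nu : {measure set (CFborel mul e) -> \bar R}) :=
  [/\ nu [set: CFborel mul e] = 1%E,
      nu (~` hull mul e Lam) = 0%E,
      @radon _ (CFborel mul e) R (CF_open mul e) (CF_compact mul e) nu &
      forall (g : G) (B : set (CFborel mul e)), measurable B ->
        nu [set ltrans mul g C | C in B] = nu B].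

Definition Cc {G : ptopologicalType} {R : realType} (f : G -> R) :=
  continuous f /\ exists K : set G, compact K /\ forall x, ~ K x -> f x = 0.

(* c is the covolume covol_nu(Lam).  The defining identity is required for
   all nonnegative f in C_c(G) (equivalent, by linearity, to all f in C_c(G)). *)
Definition is_covol {R : realType} {G : ptopologicalType}
  (mul : G -> G -> G) (e : G)
  (mu : {measure set (borel G) -> \bar R})
  (nu : {measure set (CFborel mul e) -> \bar R}) (c : R) :=
  0 < c /\
  forall f : G -> R, Cc f -> (forall x, 0 <= f x) ->
    (\int[nu]_(Gam in [set: CFborel mul e]) (\esum_(y in Gam) (f y)%:E))%E =
    ((c^-1)%:E * \int[mu]_(x in [set: borel G]) (f x)%:E)%E.

Definition frame_sum {R : realType} {G : ptopologicalType} {H : lmodType R[i]}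
  (ip : H -> H -> R[i]) (pi : G -> H -> H) (Lam : set G) (psi f : H) : \bar R :=
  (\esum_(l in Lam) ((ComplexField.Normc.normc (ip f (pi l psi))) ^+ 2)%:E)%E.

Definition bessel {R : realType} {G : ptopologicalType} {H : lmodType R[i]}
  (ip : H -> H -> R[i]) (pi : G -> H -> H) (Lam : set G) (psi : H) (C2 : R) :=
  forall f : H, (frame_sum ip pi Lam psi f <= (C2 * hnorm ip f ^+ 2)%:E)%E.

Definition lower_frame {R : realType} {G : ptopologicalType} {H : lmodType R[i]}
  (ip : H -> H -> R[i]) (pi : G -> H -> H) (Lam : set G) (psi : H) (C1 : R) :=
  forall f : H, ((C1 * hnorm ip f ^+ 2)%:E <= frame_sum ip pi Lam psi f)%E.

Definition coeff_ratio {R : realType} {G : ptopologicalType}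
  (mu : {measure set (borel G) -> \bar R})
  {H : lmodType R[i]} (ip : H -> H -> R[i]) (pi : G -> H -> H)
  (psi f : H) (c : R) : \bar R :=
  ((\int[mu]_(x in [set: borel G]) ((ComplexField.Normc.normc (voice ip pi psi f x)) ^+ 2)%:E) *
   ((hnorm ip f ^+ 2 * c)^-1)%:E)%E.

(* Main.v *)
(* The function h(g) = |<f, pi(g) psi>|^2 is only known to be measurable, so it
   is first smoothed to k(y) = \int phi(x) h(x^-1 y) dx with phi in C_c(G),
   which is continuous with integral (\int phi)(\int h).  Since pi is unitary up
   to a phase, the frame inequalities for Lam are bounds, uniform in x, on the
   sums of h over x Lam, hence on those of k.  For continuous F >= 0 the sum of
   F over Gam is lower semicontinuous in the Chabauty--Fell topology, so upper
   bounds pass from the orbit of Lam to its hull; lower bounds pass as well when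
   F has compact support, because Lam is separated.  Integrating over the hull
   against nu and using the definition of the covolume gives the bounds on
   \int k chi for cutoffs chi.  For the lower bound, the cutoff costs little: the
   tails of the sums of h over x Lam are small uniformly in x, since they are
   dominated by the tail of the integral of the square of the maximal function
   of C_psi f. *)
Require Import Defs.
From HB Require Import structures.
From mathcomp Require Import all_boot all_order all_algebra finmap.
From mathcomp Require Import all_classical all_reals all_analysis measurable_realfun.
From mathcomp Require Import complex.
From mathcomp Require Import ring lra.
Import Order.TTheory GRing.Theory Num.Theory numFieldTopology.Exports numFieldNormedType.Exports.
Local Open Scope classical_set_scope.
Local Open Scope ring_scope.

(** * Second countable locally compact groups *)

Section TopologicalGroup.
Context {G : ptopologicalType} {mul : G -> G -> G} {inv : G -> G} {e : G}.
Hypothesis HG : lcsc_group mul inv e.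
Local Notation "x ** y" := (mul x y) (at level 40, left associativity).

Lemma mulgA x y z : x ** (y ** z) = x ** y ** z.
Proof. by case: HG => -[]. Qed.

Lemma mul1g x : e ** x = x.
Proof. by case: HG => -[_ /(_ x)[]]. Qed.

Lemma mulg1 x : x ** e = x.
Proof. by case: HG => -[_ /(_ x)[]]. Qed.

Lemma mulVg x : inv x ** x = e.
Proof. by case: HG => -[_ _ /(_ x)[]]. Qed.

Lemma mulgV x : x ** inv x = e.
Proof. by case: HG => -[_ _ /(_ x)[]]. Qed.

Lemma mulKg x : cancel (mul x) (mul (inv x)).
Proof. by move=> y; rewrite mulgA mulVg mul1g. Qed.

Lemma mulKVg x : cancel (mul (inv x)) (mul x).
Proof. by move=> y; rewrite mulgA mulgV mul1g. Qed.

Lemma mulgK x : cancel (mul ^~ x) (mul ^~ (inv x)).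
Proof. by move=> y; rewrite -mulgA mulgV mulg1. Qed.

Lemma mulgKV x : cancel (mul ^~ (inv x)) (mul ^~ x).
Proof. by move=> y; rewrite -mulgA mulVg mulg1. Qed.

Lemma mulgI x : injective (mul x).
Proof. exact: can_inj (mulKg x). Qed.

Lemma invgK : involutive inv.
Proof. by move=> x; apply: (@mulgI (inv x)); rewrite mulgV mulVg. Qed.

Lemma invMg x y : inv (x ** y) = inv y ** inv x.
Proof. by apply: (@mulgI (x ** y)); rewrite mulgV mulgA mulgK mulgV. Qed.

Lemma ltransE x (A : set G) y : ltrans mul x A y = A (inv x ** y).
Proof.
rewrite propeqE; split=> [[z Az <-]|Ay]; first by rewrite mulKg.
by exists (inv x ** y) => //; rewrite mulKVg.
Qed.

Lemma continuous_mulg {T : topologicalType} (f g : T -> G) :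
  continuous f -> continuous g -> continuous (fun t => f t ** g t).
Proof.
case: HG => _ [cm _] _ _ _ cf cg t.
apply: (continuous_comp (f := fun t => (f t, g t)) (g := fun p => p.1 ** p.2)).
  exact: (cvg_pair (cf t) (cg t)).
exact: cm.
Qed.

Lemma continuous_invg {T : topologicalType} (f : T -> G) :
  continuous f -> continuous (fun t => inv (f t)).
Proof.
case: HG => _ [_ ci] _ _ _ cf t.
by apply: (continuous_comp (f := f) (g := inv)); [exact: cf|exact: ci].
Qed.

Lemma continuous_mulgl x : continuous (mul x).
Proof. by apply: (continuous_mulg (fun=> x) id) => ?; [exact: cst_continuous|]. Qed.

(** Lets two small perturbations be composed, or one of them inverted, without leaving a prescribed
    neighbourhood of [e]. *)
Lemma near_symmetric_root (A : set G) : nbhs e A ->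
  exists U, [/\ open U, U e, forall u, U u -> U (inv u) &
    forall u v, U u -> U v -> A (u ** v)].
Proof.
move=> eA.
have : nbhs (e, e) (fun p : G * G => A (p.1 ** p.2)).
  case: HG => _ [cm _] _ _ _; apply: cm => /=.
  by rewrite mul1g.
case=> -[/= V W] [/=]; rewrite /= !nbhsE => -[V' [oV' V'e] VV] [W' [oW' W'e] WW] VWA.
pose X := V' `&` W'.
have oX : open X by exact: openI.
exists (X `&` inv @^-1` X); split.
- apply: openI => //; apply: open_comp => // x _.
  by apply: (continuous_invg id) => ?.
- have ie : inv e = e by rewrite -[LHS]mulg1 mulVg.
  by split; rewrite /preimage/= ?ie.
- by move=> u [Xu Xiu]; split=> //; rewrite /preimage/= invgK.
- move=> u v [[uV _] _] [[_ vW] _].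
  by apply: (VWA (u, v)); split => /=; [exact: VV|exact: WW].
Qed.

Lemma open_ltrans x (U : set G) : open U -> open (ltrans mul x U).
Proof.
move=> oU; have -> : ltrans mul x U = mul (inv x) @^-1` U.
  by apply/seteqP; split=> y; rewrite ltransE.
by apply: open_comp => // y _; exact: continuous_mulgl.
Qed.

Lemma compact_ltrans x (K : set G) : compact K -> compact (ltrans mul x K).
Proof.
move=> cK; apply: continuous_compact => //.
by apply: continuous_subspaceT; exact: continuous_mulgl.
Qed.

Lemma compact_mulset (K L : set G) : compact K -> compact L ->
  compact [set k ** l | k in K & l in L].
Proof.
move=> cK cL.
have -> : [set k ** l | k in K & l in L] = (fun p => p.1 ** p.2) @` (K `*` L).
  apply/seteqP; split=> [_ [k Kk [l Ll <-]]|_ [[k l] [/= Kk Ll] <-]].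
    by exists (k, l).
  by exists k => //; exists l.
apply: continuous_compact; last exact: compact_setX.
by apply: continuous_subspaceT; case: HG => _ [].
Qed.

Lemma compact_nbhs (x : G) : exists2 Q : set G, compact Q & nbhs x Q.
Proof.
case: HG => _ _ _ /(_ x I) + _; case=> Q; rewrite withinET => xQ [cQ _].
by exists Q.
Qed.

Lemma closed_compact (K : set G) : compact K -> closed K.
Proof. by case: HG => _ _ h _ _; apply: compact_closed. Qed.

(** An injection [f] into [nat] numbers a countable base. Each base set contained in a compact set
    is enclosed in a compact [k i], and local compactness makes these cover [G]. *)
Lemma compact_exhaustion : exists K : nat -> set G,
  [/\ forall n, compact (K n), {homo K : m n / (m <= n)%N >-> m `<=` n} &
    \bigcup_n K n = [set: G]].
Proof.
case: HG => _ _ _ _ [B cB [Bo bB]].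
have [f finj] := countable_injP _ cB.
have HK i : exists K, compact K /\ forall A, B A -> f A = i ->
    (exists2 K', compact K' & A `<=` K') -> A `<=` K.
  have [[A [BA fA [K' cK' AK']]]|nA] :=
    pselect (exists A, [/\ B A, f A = i & exists2 K', compact K' & A `<=` K']).
    exists K'; split=> // A' BA' fA' _; suff -> : A' = A by [].
    by apply: finj; rewrite ?inE// fA'.
  exists set0; split; first exact: compact0.
  by move=> A BA fA exK; case: nA; exists A.
have [k kP] := choice HK.
exists (fun n => \big[setU/set0]_(i < n.+1) k i); split.
- by move=> n; apply: bigsetU_compact => i _; case: (kP i).
- by move=> m n mn; exact: subset_bigsetU.
- apply/seteqP; split=> // x _.
  have [Q cQ xQ] := compact_nbhs x.
  have [A [BA Ax] AQ] := bB x _ xQ.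
  exists (f A) => //; rewrite -bigcup_mkord; exists (f A) => /=; first exact: ltnSn.
  by have [_ kA] := kP (f A); apply: (kA A) Ax => //; exists Q.
Qed.

(** Complete regularity gives a bump at each point. Finitely many sets where a bump exceeds 1/2
    cover [K], so the sum of the doubled bumps, truncated at 1, works. *)
Lemma compact_cutoff (R : realType) (K : set G) : compact K ->
  exists chi : G -> R, [/\ Cc chi, forall x, 0 <= chi x <= 1 &
    forall x, K x -> chi x = 1].
Proof.
case: HG => _ _ hG lG _ cK.
have crG : @completely_regular_space G.
  exact: (@locally_compact_completely_regular G R).
have Hf x : exists f : G -> R, [/\ continuous f, forall y, 0 <= f y <= 1,
    f x = 1 & exists2 Q, compact Q & forall y, ~ Q y -> f y = 0].
  have [Q cQ xQ] := compact_nbhs x.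
  have [U [oU Ux UQ]] : exists U, [/\ open U, U x & U `<=` Q].
    by move: xQ; rewrite nbhsE => -[U [oU Ux] UQ]; exists U.
  have /uniform_separatorP : uniform_separator [set x] (~` U).
    by apply: crG => //; exact: open_closedC.
  move=> /(_ R)[f [cf f01 fx fU]]; exists (fun y => 1 - f y); split.
  - by move=> y; apply: cvgB; [exact: cvg_cst|exact: cf].
  - move=> y; have /= := f01 (f y) (imageT f y); rewrite in_itv/=; lra.
  - by rewrite (fx (f x)) ?subr0//; exists x.
  - exists Q => // y nQy; rewrite (fU (f y)) ?subrr//.
    by exists y => // /UQ.
have [f fP] := choice Hf.
have : cover_compact K by rewrite -compact_cover.
move=> /(_ G setT (fun x => [set y | 1 / 2 < f x y])) [].
- move=> x _; case: (fP x) => cf _ _ _.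
  rewrite (_ : [set _ | _] = f x @^-1` [set r | 1 / 2 < r]); last by [].
  by apply: open_comp; [move=> y _; exact: cf|exact: open_gt].
- move=> x Kx; exists x => //=; case: (fP x) => _ _ -> _; lra.
move=> D _ KD.
have [Q QP] : exists Q : set G, compact Q /\
    forall x y, x \in D -> ~ Q y -> f x y = 0.
  have Hq x : exists Q, compact Q /\ forall y, ~ Q y -> f x y = 0.
    by case: (fP x) => _ _ _ [Q]; exists Q.
  have [q qP] := choice Hq.
  exists (\big[setU/set0]_(x <- D) q x); split.
    by apply: bigsetU_compact => x _; case: (qP x).
  move=> x y xD nQ; apply: (qP x).2 => qxy; apply: nQ.
  by rewrite (big_rem x)//=; left.
exists (fun y => Num.min 1 (\sum_(x <- D) 2 * f x y)); split.
- split.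
    move=> y; apply: (@continuous_min R G (fun=> 1)); first exact: cvg_cst.
    apply: (@continuous_big R G +%R) => [|x _ z]; first exact: add_continuous.
    apply: cvgM; first exact: cvg_cst.
    by case: (fP x) => cf _ _ _; exact: cf.
  exists Q; split; first by case: QP.
  move=> y nQ; rewrite big_seq big1 ?min_r ?ler01// => x xD.
  by rewrite QP.2 ?mulr0.
- move=> y; rewrite ge_min lexx le_min ler01 andbT /=; apply: sumr_ge0 => x _.
  by case: (fP x) => _ /(_ y) ? _ _; lra.
- move=> y Ky; apply: min_l; have [x /= xD fxy] := KD y Ky.
  rewrite (big_rem x)//= -[leLHS]addr0; apply: lerD; first lra.
  by apply: sumr_ge0 => z _; case: (fP z) => _ /(_ y) ? _ _; lra.
Qed.

(** Finitely many translates of [U] cover [K], and each holds at most one point of any [x Lam];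
    their number bounds the cardinality for every [x] at once. *)
Lemma separated_card (U Lam K : set G) :
  open U -> U !=set0 -> lseparated mul U Lam -> compact K ->
  exists N : nat, forall x (A : set G), A `<=` ltrans mul x Lam -> A `<=` K ->
    finite_set A /\ (#|` fset_set A| <= N)%N.
Proof.
move=> oU [u Uu] sL; rewrite compact_cover => cK.
have [||D _ KD] := cK G setT (fun g => ltrans mul g U).
- by move=> g _; exact: open_ltrans.
- move=> k Kk; exists (k ** inv u) => //; rewrite ltransE invMg invgK -mulgA.
  by rewrite mulVg mulg1.
exists #|` D| => x A AL AK.
have /choice[g gP] : forall a, exists g, A a -> g \in D /\ ltrans mul g U a.
  move=> a; have [Aa|nA] := pselect (A a); last by exists e.
  by have [g gD ga] := KD a (AK _ Aa); exists g.
have ginj : {in A &, injective g}.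
  move=> a b; rewrite !inE => Aa Ab gab.
  apply: (@mulgI (inv x)); apply: (sL (inv x ** g a)).
  - by have := AL _ Aa; rewrite ltransE.
  - by rewrite ltransE invMg invgK -mulgA mulKVg -ltransE; case: (gP _ Aa).
  - by have := AL _ Ab; rewrite ltransE.
  - by rewrite ltransE invMg invgK -mulgA mulKVg -ltransE gab; case: (gP _ Ab).
have fA : finite_set A.
  rewrite -(eq_finite_set (inj_card_eq ginj)).
  apply: (sub_finite_set _ (finite_fset D)) => _ [a Aa <-].
  by case: (gP _ Aa).
split=> //; rewrite -(size_map g) uniq_leq_size//.
  rewrite map_inj_in_uniq ?fset_uniq// => a b.
  by rewrite !in_fset_set//; exact: ginj.
by move=> _ /mapP[a + ->]; rewrite in_fset_set// inE => /gP[].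
Qed.

(** Both points lie in the single translate z u^-1 U, a neighbourhood of [z] when [U] is open and
    contains [u]; shifting by x^-1 reduces to the separation of [Lam]. *)
Lemma separated_translate (U Lam : set G) (u x z a b : G) :
  lseparated mul U Lam -> ltrans mul x Lam a -> ltrans mul x Lam b ->
  U (u ** (inv z ** a)) -> U (u ** (inv z ** b)) -> a = b.
Proof.
move=> sL; rewrite !ltransE => La Lb Ua Ub.
have inU c : U (u ** (inv z ** c)) ->
    ltrans mul (inv x ** z ** inv u) U (inv x ** c).
  by rewrite ltransE !invMg !invgK -!mulgA mulKVg.
by apply: (@mulgI (inv x)); apply: (sL _ _ _ La _ Lb); apply: inU.
Qed.

End TopologicalGroup.

(** * Orbit sums on the hull *)

(** Serves to compare a finite partial sum over one set with the sum over a nearby set, [l] matching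
    each point with a close one; injectivity prevents double counting. *)
Lemma sum_fset_le_esum {R : realType} {T : choiceType} (A : {fset T})
    (C : set T) (l : T -> T) (F : T -> R) :
  (forall x, 0 <= F x) -> {in A &, injective l} ->
  (forall a, a \in A -> C (l a)) ->
  (\sum_(a <- A) (F (l a))%:E <= \esum_(y in C) (F y)%:E)%E.
Proof.
move=> F0 linj lC.
have -> : (\sum_(a <- A) (F (l a))%:E = \esum_(a in [set` A]) (F (l a))%:E)%E.
  by rewrite esum_fset// ?fsbig_finite// ?set_fsetK// => i _; rewrite lee_fin.
have sinj : set_inj [set` A] l by move=> x y; rewrite !inE; exact: linj.
rewrite -(esum_image [set` A] l (fun y => (F y)%:E) sinj).
apply: ereal_sup_le => _ [X [fX XA] <-]; exists X => //; split=> // y /XA[a aA <-].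
exact: lC.
Qed.

Section Hull.
Context {R : realType} {G : ptopologicalType} {mul : G -> G -> G} {inv : G -> G}
  {e : G}.
Hypothesis HG : lcsc_group mul inv e.
Local Notation "x ** y" := (mul x y) (at level 40, left associativity).
Let gA := mulgA HG.
Let g1 := mulg1 HG.
Let gK := mulgK HG.
Let gKg := mulKg HG.

Local Notation orbit_sum F Gam := (\esum_(y in Gam) (F y)%:E)%E.

Lemma esum_ltrans (F : G -> R) x (Lam : set G) :
  orbit_sum F (ltrans mul x Lam) = (\esum_(y in Lam) (F (x ** y))%:E)%E.
Proof.
by rewrite (esum_image Lam (mul x))// => y z _ _; exact: (mulgI HG).
Qed.

(** The joint neighbourhoods are the form from which near-covering compactness produces estimates
    uniform over a compact set. *)
Lemma near_prod_lt (f : G * G -> R) (p : G) (d : R) :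
  continuous f -> f (p, e) = 0 -> 0 < d ->
  \forall q \near p & u \near e, `|f (q, u)| < d.
Proof.
move=> cf f0 d0; have := cf (p, e); rewrite /continuous_at f0 => /(_ (ball 0 d)).
move=> /(_ (nbhsx_ballx _ _ d0)) fd.
have {}fd : nbhs (p, e) [set z : G * G | ball 0 d (f z)] := fd.
apply: (filterS _ fd) => -[q u] /=.
by rewrite /ball/= sub0r normrN.
Qed.

Lemma near_mulr_continuous (F : G -> R) (p : G) (d : R) :
  continuous F -> 0 < d ->
  \forall q \near p & u \near e, `|F (q ** u) - F q| < d.
Proof.
move=> cF; apply: (near_prod_lt (fun z => F (z.1 ** z.2) - F z.1)).
  move=> z; apply: cvgB; last first.
    by apply: (continuous_comp (f := fst)); [exact: cvg_fst|exact: cF].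
  apply: (continuous_comp (f := fun z : G * G => z.1 ** z.2)); last exact: cF.
  by case: HG => _ [cm _] _ _ _; exact: cm.
by rewrite g1 subrr.
Qed.

Lemma near_mull_continuous (F : G -> R) (p : G) (d : R) :
  continuous F -> 0 < d ->
  \forall q \near p & u \near e, `|F (u ** q) - F q| < d.
Proof.
move=> cF; apply: (near_prod_lt (fun z => F (z.2 ** z.1) - F z.1)).
  move=> z; apply: cvgB; last first.
    by apply: (continuous_comp (f := fst)); [exact: cvg_fst|exact: cF].
  apply: (continuous_comp (f := fun z : G * G => z.2 ** z.1)); last exact: cF.
  by apply: (continuous_mulg HG) => ?; [exact: cvg_snd|exact: cvg_fst].
by rewrite (mul1g HG) subrr.
Qed.

Lemma near_neq (z : G) : z != e -> \forall u \near e, u <> z.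
Proof.
move=> ze; have : open (~` [set z]).
  by apply: closed_openC; apply: accessible_closed_set1; apply: hausdorff_accessible;
    case: HG.
rewrite openE => /(_ e); apply => /= ez.
by rewrite ez eqxx in ze.
Qed.

(** A finite partial sum over some [A] inside [C] already exceeds [a]. With [A] as the compact set
    and [U] small, a nearby [C'] has distinct points close to those of [A], where [F] is almost the
    same. *)
Lemma orbit_sum_lsc (F : G -> R) (C : set G) (a : \bar R) :
  continuous F -> (forall x, 0 <= F x) -> (a < orbit_sum F C)%E ->
  exists K U : set G, [/\ compact K, open U, U e &
    forall C', CF_nbhd mul K U C C' -> (a < orbit_sum F C')%E].
Proof.
move=> cF F0 /ereal_sup_gt[_ [X [fX XC] <-]].
rewrite fsbig_finite// => aX; set A := fset_set X in aX.
have AX x : x \in A -> X x by rewrite in_fset_set// inE.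
have [d d0 ad] : exists2 d : R, 0 < d &
    (a + d%:E < \sum_(x <- A) (F x)%:E)%E.
  move: aX; rewrite sumEFin; case: a => [r||]//=.
    rewrite lte_fin => h; exists ((\sum_(x <- A) F x - r) / 2); first lra.
    by rewrite -EFinD lte_fin; lra.
  by move=> _; exists 1 => //; rewrite ltNye.
(* The margin [d] is shared among the points of [A]; the successor keeps the denominator nonzero
   when [A] is empty. *)
pose eps := d / (#|` A|.+1)%:R.
have eps0 : 0 < eps by rewrite divr_gt0// ltr0n.
pose N1 := \bigcap_(x in [set` A]) [set u | `|F (x ** u) - F x| < eps].
(* [N2] excludes the quotients x^-1 y of distinct points of [A], so that matched points stay
   distinct: x u = y v would give u v^-1 = x^-1 y. *)
pose N2 := \bigcap_(z in [set` (A `*` A)%fset])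
  [set u | z.1 != z.2 -> u <> inv z.1 ** z.2].
have eN1 : nbhs e N1.
  apply: filter_bigI => x _.
  have /nbhs_singleton : \forall q \near x, \forall u \near e,
      `|F (q ** u) - F q| < eps.
    exact: nearP_dep (near_mulr_continuous F x eps cF eps0).
  by [].
have eN2 : nbhs e N2.
  apply: filter_bigI => -[x y] _ /=.
  have [->|xy] := eqVneq x y; first by apply: nearW => u.
  have : inv x ** y != e.
    by apply: contra_neq xy => xye; rewrite -(mulKVg HG x y) xye g1.
  by move=> /near_neq nz; apply: (filterS _ nz) => u /= uz _.
have [U [oU Ue Usym UN]] := near_symmetric_root HG _ (filterI eN1 eN2).
exists [set` A], U; split=> //; first exact/finite_compact/finite_fset.
move=> C' [_ CC'].
have /choice[l lP] : forall x, exists y, x \in A ->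
    C' y /\ exists2 u, U u & y = x ** u.
  move=> x; have [xA|nx] := boolP (x \in A); last by exists e.
  have [y C'y [u Uu yu]] : [set mul c u | c in C' & u in U] x.
    by apply: CC'; split=> //; exact/XC/AX.
  by exists y => _; split=> //; exists (inv u); [exact: Usym|rewrite -yu gK].
have linj : {in A &, injective l}.
  move=> x y xA yA lxy; have [_ [u Uu lx]] := lP x xA.
  have [_ [v Uv ly]] := lP y yA.
  apply: contrapT => /eqP xy; have [_ /(_ (x, y))] := UN _ _ Uu (Usym _ Uv).
  apply => //=; first by rewrite inE/= xA yA.
  by rewrite -(gK v y) -ly -lxy lx -gA gKg.
apply: lt_le_trans (sum_fset_le_esum A C' l F F0 linj _); last first.
  by move=> x /lP[].
rewrite -(@lteD2rE _ d%:E)//; apply: (lt_le_trans ad).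
rewrite !sumEFin -EFinD lee_fin.
have -> : d = eps *+ #|` A|.+1 by rewrite -mulr_natr divfK// pnatr_eq0.
apply: (@le_trans _ _ (\sum_(x <- A) (F (l x) + eps))).
  rewrite big_seq [leRHS]big_seq; apply: ler_sum => x xA.
  have [_ [u Uu ->]] := lP x xA.
  have [/(_ x xA)/= + _] := UN _ _ Uu Ue; rewrite g1 ltr_distlC; lra.
rewrite big_split/= lerD2l big_const_seq count_predT iter_addr_0.
by rewrite mulrS lerDr ltW.
Qed.

(** By lower semicontinuity, the sets whose sum exceeds a given level form a Chabauty-Fell open
    family. *)
Lemma measurable_orbit_sum (F : G -> R) :
  continuous F -> (forall x, 0 <= F x) ->
  measurable_fun [set: CFborel mul e]
    (fun Gam : CFborel mul e => orbit_sum F Gam).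
Proof.
move=> cF F0; apply: (measurability _ (ErealGenOInfty.measurableE R)).
move=> /= _ [_ [a ->]] <-; apply: measurableI => //; apply: sub_sigma_algebra.
move=> C _; rewrite /preimage/= in_itv/= andbT => aC.
have [K [U [cK oU Ue KU]]] := orbit_sum_lsc _ _ _ cF F0 aC.
by exists K, U; split=> // C' _ /KU; rewrite in_itv/= andbT.
Qed.

(** If a basic neighbourhood of [C] misses the orbit, a finer one misses the hull: chaining two
    approximations within [W] gives one within [U]. *)
Lemma CF_open_setC_hull (Lam : set G) : CF_open mul e (~` hull mul e Lam).
Proof.
move=> C clC nC.
have : ~ forall K U : set G, compact K -> open U -> U e ->
    exists x, CF_nbhd mul K U C (ltrans mul x Lam).
  by move=> h; apply: nC; split.
move=> /existsNP[K] /existsNP[U] /not_implyP[cK] /not_implyP[oU] /not_implyP[Ue nx].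
have [Q cQ eQ] := compact_nbhs HG e.
have eU : nbhs e U by exact: open_nbhs_nbhs.
have [W [oW We Wsym WUQ]] := near_symmetric_root HG _ (filterI eU eQ).
(* The intermediate point of the chain differs from a point of [K] by an element of [W]; enlarging
   [K] to K Q keeps it in the compact set being tested. *)
exists [set k ** q | k in K & q in Q], W; split=> //.
  exact: (compact_mulset HG).
have KK' k w : K k -> W w -> [set k ** q | k in K & q in Q] (k ** w).
  move=> Kk Ww; exists k => //; exists w => //.
  by have [_] := WUQ _ _ Ww We; rewrite g1.
have KK k : K k -> [set k ** q | k in K & q in Q] k.
  by move=> Kk; have := KK' _ _ Kk We; rewrite g1.
move=> C' clC' [C'C CC'] [_ /(_ _ W (compact_mulset HG _ _ cK cQ) oW We)].
move=> [x [xC' C'x]]; apply: nx; exists x; split.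
- move=> p [xp Kp]; have [c' C'c' [u Wu pE]] := xC' _ (conj xp (KK _ Kp)).
  have c'E : c' = p ** inv u by rewrite -pE gK.
  have [|c Cc [v Wv cE]] := C'C c'.
    by split=> //; rewrite c'E; apply: KK' => //; exact: Wsym.
  exists c => //; exists (v ** u); first by have [] := WUQ _ _ Wv Wu.
  by rewrite gA cE.
- move=> c [Cc Kc]; have [c' C'c' [u Wu cE]] := CC' _ (conj Cc (KK _ Kc)).
  have c'E : c' = c ** inv u by rewrite -cE gK.
  have [|p xp [v Wv pE]] := C'x c'.
    by split=> //; rewrite c'E; apply: KK' => //; exact: Wsym.
  exists p => //; exists (v ** u); first by have [] := WUQ _ _ Wv Wu.
  by rewrite gA pE.
Qed.

Lemma measurable_hull (Lam : set G) :
  measurable (hull mul e Lam : set (CFborel mul e)).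
Proof.
rewrite -(setCK (hull _ _ _)); apply: measurableC.
by apply: sub_sigma_algebra; exact: CF_open_setC_hull.
Qed.

Lemma hull_orbit_sum_le (F : G -> R) (Lam Gam : set G) (b : \bar R) :
  continuous F -> (forall x, 0 <= F x) ->
  (forall x, (orbit_sum F (ltrans mul x Lam) <= b)%E) ->
  hull mul e Lam Gam -> (orbit_sum F Gam <= b)%E.
Proof.
move=> cF F0 Fb [_ hGam]; rewrite leNgt; apply/negP => bG.
have [K [U [cK oU Ue KU]]] := orbit_sum_lsc _ _ _ cF F0 bG.
have [x /KU] := hGam K U cK oU Ue.
by rewrite ltNge Fb.
Qed.

(** A nearby [x Lam] is compared with [Gam] on the compact set [K] off which [F] vanishes. Each of
    its points there is close to a point of [Gam], separation makes this matching injective, and the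
    error is controlled because at most [N] points occur. *)
Lemma hull_orbit_sum_ge (F : G -> R) (U0 Lam Gam : set G) (b : R) :
  open U0 -> U0 !=set0 -> lseparated mul U0 Lam ->
  Cc F -> (forall x, 0 <= F x) ->
  (forall x, (b%:E <= orbit_sum F (ltrans mul x Lam))%E) ->
  hull mul e Lam Gam -> (b%:E <= orbit_sum F Gam)%E.
Proof.
move=> oU0 [u0 U0u0] sLam [cF [K [cK FK]]] F0 Fb [_ hGam].
have [N NP] := separated_card HG _ _ _ oU0 (ex_intro _ u0 U0u0) sLam cK.
apply/lee_addgt0Pr => d d0.
(* [N] does not depend on [x], so [eps], then [U], then [x] can be chosen after it; [N] errors of
   size [eps] add up to at most [d]. *)
pose eps := d / N.+1%:R.
have eps0 : 0 < eps by rewrite divr_gt0// ltr0n.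
have eU0 : nbhs e (ltrans mul (inv u0) U0).
  apply: open_nbhs_nbhs; split; first exact: (open_ltrans HG).
  by rewrite (ltransE HG) (invgK HG) g1.
have eF : \forall u \near e, K `<=` [set p | `|F (p ** u) - F p| < eps].
  move/compact_near_coveringP: cK; apply => p Kp.
  exact: near_mulr_continuous.
have [U [oU Ue Usym UU]] := near_symmetric_root HG _ (filterI eU0 eF).
have [x [xG _]] := hGam K U cK oU Ue.
have [|fA cA] := NP x (ltrans mul x Lam `&` K) _ (@subIsetr _ _ _).
  by move=> ? [].
set A := fset_set (ltrans mul x Lam `&` K) in cA.
have AX y : y \in A -> (ltrans mul x Lam `&` K) y by rewrite in_fset_set// inE.
have /choice[l lP] : forall y, exists c, y \in A ->
    Gam c /\ exists2 u, U u & y = c ** u.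
  move=> y; have [yA|ny] := boolP (y \in A); last by exists e.
  have [c Gc [u Uu yE]] := xG _ (AX _ yA).
  by exists c => _; split=> //; exists u.
have linj : {in A &, injective l}.
  move=> y z yA zA lyz; have [_ [u Uu yE]] := lP y yA.
  have [_ [v Uv zE]] := lP z zA.
  (* Points matched with the same [l y] lie in one translate of [U0] around it, hence agree by
     separation. *)
  have inU w : U w -> U0 (u0 ** (inv (l y) ** (l y ** w))).
    move=> Uw; have [+ _] := UU _ _ Uw Ue.
    by rewrite g1 gKg (ltransE HG) (invgK HG).
  apply: (separated_translate HG U0 Lam u0 x (l y)) => //.
  - by have [] := AX _ yA.
  - by have [] := AX _ zA.
  - by have := inU _ Uu; rewrite -yE.
  - by have := inU _ Uv; rewrite {2}lyz -zE.
apply: (le_trans (Fb x)).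
have -> : orbit_sum F (ltrans mul x Lam) = orbit_sum F (ltrans mul x Lam `&` K).
  rewrite (esumID K) => [|y _]; last by rewrite lee_fin.
  by rewrite (@esum1 _ _ (_ `&` ~` K)) ?adde0// => y [_ /FK ->].
rewrite esum_fset//; last by move=> y _; rewrite lee_fin.
rewrite fsbig_finite//= -/A.
apply: (@le_trans _ _ (\sum_(y <- A) (F (l y))%:E + d%:E)%E); last first.
  by apply: leeD2r; apply: sum_fset_le_esum => // y /lP[].
rewrite !sumEFin -EFinD lee_fin.
apply: (@le_trans _ _ (\sum_(y <- A) (F (l y) + eps))).
  rewrite big_seq [leRHS]big_seq; apply: ler_sum => y yA.
  have [_ [u Uu yE]] := lP y yA.
  have [_ /(_ y (AX _ yA).2)/=] := UU _ _ (Usym _ Uu) Ue.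
  by rewrite g1 {1}yE gK ltr_distlC; lra.
rewrite big_split/= lerD2l big_const_seq count_predT iter_addr_0.
rewrite -[leRHS](@divfK _ N.+1%:R) ?pnatr_eq0// -/eps -[leLHS]mulr_natr.
by rewrite ler_wpM2l ?(ltW eps0)// ler_nat (leq_trans cA).
Qed.

End Hull.

(** * Haar measure and convolution *)

Lemma measurable_fun_borel d (T : measurableType d) (G : ptopologicalType)
    (f : T -> borel G) :
  (forall U : set G, open U -> measurable (f @^-1` U)) ->
  measurable_fun [set: T] f.
Proof.
move=> fU; apply: (measurability (@open G : set (set (borel G))) erefl).
by move=> _ [U oU <-]; rewrite setTI; exact: fU.
Qed.

Lemma continuous_measurable_borel (R : realType) (G : ptopologicalType)
    (f : G -> R) :
  continuous f -> measurable_fun [set: borel G] (f : borel G -> R).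
Proof.
move=> cf; apply: (measurability _ (RGenOpens.measurableE R)).
move=> _ [_ [a [b ->] <-]]; rewrite setTI; apply: sub_sigma_algebra.
by apply: open_comp => [x _|]; [exact: cf|exact: interval_open].
Qed.

(** The source carries the product sigma-algebra; second countability writes an open subset of G * G
    as a countable union of open rectangles. *)
Lemma continuous_measurable_prod (G : ptopologicalType) (f : G * G -> G) :
  @second_countable G -> continuous f ->
  measurable_fun [set: borel G * borel G] (f : borel G * borel G -> borel G).
Proof.
move=> [B cB [Bo bB]] cf; apply: measurable_fun_borel => U oU.
pose P := [set AB : set G * set G |
  [/\ B AB.1, B AB.2 & AB.1 `*` AB.2 `<=` f @^-1` U]].
have -> : f @^-1` U = \bigcup_(AB in P) (AB.1 `*` AB.2).
  apply/seteqP; split=> [[x y] fxy|z [AB [_ _ ABU] zAB]]; last exact: ABU.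
  have : nbhs (x, y) (f @^-1` U) by apply: cf; exact: open_nbhs_nbhs.
  move=> [[V W]] [/= /bB[A1 [BA1 A1x] A1V] /bB[A2 [BA2 A2y] A2W]] VWU.
  exists (A1, A2) => //; split=> //= -[u v] [/= ? ?].
  by apply: VWU; split; [exact: A1V|exact: A2W].
rewrite (bigcup_set_type P); apply: countable_bigcupT_measurable.
  rewrite (eq_countable (card_setT P)).
  apply: (@sub_countable _ _ _ (B `*` B)); last exact: countableX.
  by apply: subset_card_le => -[A1 A2] [].
move=> [AB /=]; rewrite inE => -[BA1 BA2 _] /=.
by apply: measurableX; apply: sub_sigma_algebra; exact: Bo.
Qed.

Section HaarMeasure.
Context {R : realType} {G : ptopologicalType} {mul : G -> G -> G} {inv : G -> G}
  {e : G} {mu : {measure set (borel G) -> \bar R}}.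
Hypotheses (HG : lcsc_group mul inv e) (Hmu : left_haar mul mu).
Local Notation "x ** y" := (mul x y) (at level 40, left associativity).
Let gA := mulgA HG.
Let gV := mulgV HG.
Let gKg := mulKg HG.

Lemma compact_measurable_borel (K : set G) :
  compact K -> measurable (K : set (borel G)).
Proof.
move=> cK; rewrite -(setCK K); apply: measurableC; apply: sub_sigma_algebra.
by apply: closed_openC; exact: (closed_compact HG).
Qed.

Lemma haar_compact_lty (K : set G) : compact K -> (mu K < +oo)%E.
Proof. by case: Hmu => _ [+ _ _] _; apply. Qed.

Lemma haar_sigma_finite : sigma_finite [set: borel G] mu.
Proof.
have [K [cK _ KT]] := compact_exhaustion HG.
exists K => // n; split; first exact: compact_measurable_borel.
exact: haar_compact_lty.
Qed.

Lemma measurable_ltrans x (A : set (borel G)) :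
  measurable A -> measurable (ltrans mul x A : set (borel G)).
Proof.
move=> mA; have -> : ltrans mul x A = mul (inv x) @^-1` A.
  by apply/seteqP; split=> y; rewrite (ltransE HG).
rewrite -[X in measurable X]setTI.
suff : measurable_fun [set: borel G] (mul (inv x) : borel G -> borel G) by exact.
apply: measurable_fun_borel => U oU; apply: sub_sigma_algebra.
by apply: open_comp => // y _; exact: (continuous_mulgl HG).
Qed.

Lemma measurable_mull x : measurable_fun [set: borel G] (mul x : borel G -> borel G).
Proof.
apply: measurable_fun_borel => U oU; apply: sub_sigma_algebra.
by apply: open_comp => // y _; exact: (continuous_mulgl HG).
Qed.

Lemma measurable_inv : measurable_fun [set: borel G] (inv : borel G -> borel G).
Proof.
apply: measurable_fun_borel => U oU; apply: sub_sigma_algebra.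
by apply: open_comp => // y _; apply: (continuous_invg HG id) => ?.
Qed.

Lemma measurable_fun_mulVr (h : G -> R) (y : G) :
  measurable_fun [set: borel G] (h : borel G -> R) ->
  measurable_fun [set: borel G] (fun x : borel G => h (inv x ** y)).
Proof.
move=> mh.
apply: (measurableT_comp mh
  (_ : measurable_fun _ (fun x : borel G => inv x ** y : borel G))).
apply: measurable_fun_borel => U oU; apply: sub_sigma_algebra.
apply: open_comp => // x _; apply: (continuous_mulg HG); last exact: cst_continuous.
by apply: (continuous_invg HG id) => ?.
Qed.

Lemma haar_integral_mull x (f : borel G -> \bar R) :
  measurable_fun [set: borel G] f -> (forall y, 0 <= f y)%E ->
  (\int[mu]_(y in [set: borel G]) f (x ** y) =
   \int[mu]_(y in [set: borel G]) f y)%E.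
Proof.
move=> mf f0.
have := @ge0_integral_pushforward _ _ _ _ _ _ (measurable_mull x) mu setT f
  measurableT mf (fun y _ => f0 y).
rewrite preimage_setT => <-.
apply: eq_measure_integral => [|? A mA _]; first exact: measurable_mull.
have <- : mu (ltrans mul (inv x) A) = mu A by case: Hmu => h _ _; exact: h.
congr (mu _); apply/seteqP; split => y; rewrite (ltransE HG).
  by rewrite (invgK HG).
by rewrite (invgK HG).
Qed.

(** Monotone convergence along a compact exhaustion. *)
Lemma integral_le_compact (T : borel G -> \bar R) (M : \bar R) :
  measurable_fun [set: borel G] T -> (forall x, 0 <= T x)%E ->
  (forall K : set G, compact K ->
    (\int[mu]_(x in (K : set (borel G))) T x <= M)%E) ->
  (\int[mu]_(x in [set: borel G]) T x <= M)%E.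
Proof.
move=> mT T0 TM; have [K [cK ndK KT]] := compact_exhaustion HG.
have ndK' : nondecreasing_seq (K : nat -> set (borel G)).
  by move=> m n mn; rewrite subsetEset; exact: ndK.
have := @ge0_nondecreasing_set_cvg_integral _ (borel G) R K T mu ndK'
  (fun n => compact_measurable_borel _ (cK n))
  (fun n => measurable_funTS mT) (fun n x _ => T0 x).
rewrite KT => cvgT; rewrite -(cvg_lim _ cvgT)//; apply: lime_le.
  by apply/cvg_ex; exists (\int[mu]_(x in [set: borel G]) T x)%E.
by apply: nearW => n; exact: TM.
Qed.

(** By contradiction: if every compact set left a tail above [eps], all integrals over compact sets
    would be at most I - eps, hence so would [I] itself. *)
Lemma integral_compact_tail (T : borel G -> \bar R) (eps : R) :
  measurable_fun [set: borel G] T -> (forall x, 0 <= T x)%E ->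
  (\int[mu]_(x in [set: borel G]) T x < +oo)%E -> 0 < eps ->
  exists2 K : set G, compact K &
    (\int[mu]_(x in (~` K : set (borel G))) T x <= eps%:E)%E.
Proof.
move=> mT T0 Toy eps0; apply: contrapT => nK.
set I := (\int[mu]_(x in [set: borel G]) T x)%E in Toy.
have I0 : (0 <= I)%E by exact: integral_ge0.
have Ifin : I \is a fin_num by rewrite ge0_fin_numE.
suff : (I <= I - eps%:E)%E.
  by rewrite leeBrDr// -[leRHS]adde0 leeD2lE// lee_fin leNgt eps0.
apply: integral_le_compact => // K cK.
have mK : measurable (K : set (borel G)) by exact: compact_measurable_borel.
have mKC : measurable (~` K : set (borel G)) by exact: measurableC.
rewrite leeBrDr// /I -(setUv (K : set (borel G))) ge0_integral_setU//.
- rewrite leeD2l//; apply/ltW; rewrite ltNge; apply/negP => TK.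
  by apply: nK; exists K.
- by rewrite setUv.
- by rewrite disj_set2E setICr.
Qed.

(** [mu'] is [mu] bundled with its sigma-finiteness, as Tonelli's theorem requires. *)
Let mu_sfinite := isSFinite.Build _ _ _ (Measure.sort mu)
  (sfinite_measure_sigma_finite haar_sigma_finite).
Let mu_sigma_finite := isSigmaFinite.Build _ _ _ (Measure.sort mu)
  haar_sigma_finite.
Let mu' : {sigma_finite_measure set (borel G) -> \bar R} :=
  HB.pack_for (SigmaFiniteMeasure.type (borel G) R) (Measure.sort mu)
    mu_sfinite mu_sigma_finite.

Lemma haar_fubini (f : G * G -> \bar R) :
  measurable_fun [set: borel G * borel G] f -> (forall z, 0 <= f z)%E ->
  (\int[mu]_(x in [set: borel G]) \int[mu]_(y in [set: borel G]) f (x, y) =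
   \int[mu]_(y in [set: borel G]) \int[mu]_(x in [set: borel G]) f (x, y))%E.
Proof.
move=> mf f0.
exact: (@fubini_tonelli _ _ _ _ R mu' mu' f mf f0).
Qed.

(** Group convolution, extended-real-valued so that it makes sense before integrability is known;
    [conv_fin_num] gives finiteness for bounded [h]. *)
Definition conv (phi h : G -> R) (y : G) : \bar R :=
  (\int[mu]_(x in [set: borel G]) (phi x * h (inv x ** y))%:E)%E.

(** * Convolution of a cutoff with a bounded measurable function *)

Section Convolution.
Context (phi h : G -> R) (M : R).
Hypotheses (cphi : Cc phi) (phi0 : forall x, 0 <= phi x).
Hypotheses (phi1 : forall x, phi x <= 1).
Hypotheses (mh : measurable_fun [set: borel G] (h : borel G -> R)).
Hypotheses (h0 : forall x, 0 <= h x) (hM : forall x, h x <= M).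

Let mphi : measurable_fun [set: borel G] (phi : borel G -> R).
Proof. by apply: continuous_measurable_borel; case: cphi. Qed.

Lemma haar_integral_Cc_lty :
  (\int[mu]_(x in [set: borel G]) (phi x)%:E < +oo)%E.
Proof.
have [_ [K [cK phiK]]] := cphi.
have mK := compact_measurable_borel K cK.
apply: (@le_lt_trans _ _ (\int[mu]_(x in [set: borel G]) (\1_K x)%:E)%E).
  apply: ge0_le_integral => //.
  - by move=> x _; rewrite lee_fin.
  - exact/measurable_EFinP.
  - by apply/measurable_EFinP; exact: measurable_indic.
  - move=> x _; rewrite lee_fin indicE; case: (boolP (x \in K)) => [_|].
      exact: phi1.
    by rewrite notin_setE => /phiK ->.
by rewrite integral_indic// setIT haar_compact_lty.
Qed.

Lemma measurable_conv_kernel : measurable_fun [set: borel G * borel G]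
  (fun z : borel G * borel G => (phi z.1 * h (inv z.1 ** z.2))%:E).
Proof.
apply/measurable_EFinP; apply: measurable_funM.
  exact: (measurableT_comp mphi measurable_fst).
apply: (measurableT_comp mh); apply: (continuous_measurable_prod G).
  by case: HG.
apply: (continuous_mulg HG) => [|?]; last exact: cvg_snd.
by apply: (continuous_invg HG) => ?; exact: cvg_fst.
Qed.

Let kernel_ge0 (z : G * G) : (0 <= (phi z.1 * h (inv z.1 ** z.2))%:E)%E.
Proof. by rewrite lee_fin mulr_ge0. Qed.

Let mhl x : measurable_fun [set: borel G] (fun y : borel G => h (inv x ** y)).
Proof. exact: (measurableT_comp mh (measurable_mull _)). Qed.

Let mhr y : measurable_fun [set: borel G] (fun x : borel G => h (inv x ** y)).
Proof. exact: measurable_fun_mulVr. Qed.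

(** Tonelli's theorem puts the integral over [y] inside, where left invariance removes the shift by
    x^-1. *)
Lemma integral_conv : (\int[mu]_(y in [set: borel G]) conv phi h y =
  (\int[mu]_(x in [set: borel G]) (phi x)%:E) *
  (\int[mu]_(x in [set: borel G]) (h x)%:E))%E.
Proof.
rewrite /conv -(haar_fubini _ measurable_conv_kernel kernel_ge0)/=.
rewrite -ge0_integralZr//; last first.
- by apply: integral_ge0 => x _; rewrite lee_fin.
- by move=> x _; rewrite lee_fin.
- exact/measurable_EFinP.
apply: eq_integral => x _.
under eq_integral do rewrite EFinM.
rewrite ge0_integralZl//; last first.
- by rewrite lee_fin.
- by move=> y _; rewrite lee_fin.
- exact/measurable_EFinP.
congr (_ * _)%E.
apply: (haar_integral_mull (inv x) (fun y => (h y)%:E)).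
- exact/measurable_EFinP.
- by move=> y; rewrite lee_fin.
Qed.

Lemma conv_ge0 y : (0 <= conv phi h y)%E.
Proof. by apply: integral_ge0 => x _; rewrite lee_fin mulr_ge0. Qed.

Lemma conv_fin_num y : conv phi h y \is a fin_num.
Proof.
rewrite ge0_fin_numE ?conv_ge0//.
have M0 : 0 <= M by exact: le_trans (h0 e) (hM e).
apply: (@le_lt_trans _ _ (\int[mu]_(x in [set: borel G]) (M%:E * (phi x)%:E))%E).
  apply: ge0_le_integral => //.
  - by move=> x _; rewrite lee_fin mulr_ge0.
  - by apply/measurable_EFinP; apply: measurable_funM.
  - by apply: measurable_funeM; exact/measurable_EFinP.
  - by move=> x _; rewrite -EFinM lee_fin mulrC ler_wpM2r.
rewrite ge0_integralZl//.
- by rewrite lte_mul_pinfty// haar_integral_Cc_lty.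
- exact/measurable_EFinP.
- by move=> x _; rewrite lee_fin.
Qed.

(** Turns sums of the convolution into averages, weighted by [phi], of sums of [h] over translated
    sets, to which orbit bounds on [h] apply. *)
Lemma sum_conv (A : seq G) : (\sum_(a <- A) conv phi h a =
  \int[mu]_(x in [set: borel G]) (phi x * \sum_(a <- A) h (inv x ** a))%:E)%E.
Proof.
rewrite /conv -ge0_integral_sum//.
- by apply: eq_integral => x _; rewrite sumEFin mulr_sumr.
- by move=> a; apply/measurable_EFinP; apply: measurable_funM.
- by move=> a x _; rewrite lee_fin mulr_ge0.
Qed.

Let conv_kernel_translate y : measurable_fun [set: borel G]
  (fun z : borel G => (phi (y ** z) * h (inv z))%:E).
Proof.
apply/measurable_EFinP; apply: measurable_funM.
  exact: (measurableT_comp mphi (measurable_mull y)).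
exact: (measurableT_comp mh measurable_inv).
Qed.

(** The substitution x = y z moves the dependence on [y] from [h], only measurable, to the
    continuous [phi]. *)
Lemma conv_translate y : conv phi h y =
  (\int[mu]_(z in [set: borel G]) (phi (y ** z) * h (inv z))%:E)%E.
Proof.
rewrite /conv -(haar_integral_mull y).
- by apply: eq_integral => z _; rewrite (invMg HG) (mulgKV HG).
- by apply/measurable_EFinP; apply: measurable_funM.
- by move=> x; rewrite lee_fin mulr_ge0.
Qed.

(** One half of the continuity estimate: the allowed gap [d] on [L] is integrated against [h], which
    is at most [M]. *)
Lemma conv_le y y' (d : R) (L : set G) : 0 <= d -> compact L ->
  (forall z, phi (y ** z) <= phi (y' ** z) + d * \1_L z) ->
  (conv phi h y <= conv phi h y' + (d * M * fine (mu L))%:E)%E.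
Proof.
move=> d0 cL yy'; have mL := compact_measurable_borel L cL.
have M0 : 0 <= M by exact: le_trans (h0 e) (hM e).
have -> : ((d * M * fine (mu L))%:E =
    \int[mu]_(z in [set: borel G]) ((d * M)%:E * (\1_L z)%:E))%E.
  rewrite ge0_integralZl//; last 2 first.
  - by apply/measurable_EFinP; exact: measurable_indic.
  - by rewrite lee_fin mulr_ge0.
  rewrite integral_indic// setIT EFinM fineK// ge0_fin_numE//.
  exact: haar_compact_lty.
rewrite !conv_translate -ge0_integralD//; last 3 first.
- by move=> z _; rewrite lee_fin mulr_ge0.
- by move=> z _; rewrite -EFinM lee_fin !mulr_ge0.
- by apply: measurable_funeM; apply/measurable_EFinP; exact: measurable_indic.
apply: ge0_le_integral => //.
- by move=> z _; rewrite lee_fin mulr_ge0.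
- apply: emeasurable_funD => //.
  by apply: measurable_funeM; apply/measurable_EFinP; exact: measurable_indic.
move=> z _; rewrite -EFinM -EFinD lee_fin.
apply: le_trans (ler_wpM2r (h0 _) (yy' z)) _; rewrite mulrDl lerD2l.
by rewrite mulrAC ler_wpM2r// ler_wpM2l.
Qed.

Lemma continuous_conv : continuous (fun y => fine (conv phi h y) : R).
Proof.
have M0 : 0 <= M by exact: le_trans (h0 e) (hM e).
have [cphi' [K [cK phiK]]] := cphi.
move=> y0; apply/cvgrPdist_lt => eps eps0.
have [W cW eW] := compact_nbhs HG e.
(* [L] is W^-1 K. For [y] in W y0, both phi(y z) and phi(y0 z) vanish unless y0 z lies in [L], that
   is, unless [z] lies in [L']. *)
have cL : compact [set mul u v | u in inv @` W & v in K].
  apply: (compact_mulset HG) => //; apply: continuous_compact => //.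
  by apply: continuous_subspaceT; apply: (continuous_invg HG id) => ?.
set L := [set mul u v | u in inv @` W & v in K] in cL.
have cL' := compact_ltrans HG (inv y0) L cL.
set L' := ltrans mul (inv y0) L in cL'.
pose m := fine (mu L').
have m0 : 0 <= m by exact/fine_ge0/measure_ge0.
(* The added 1 keeps the denominator positive when [M * m] is 0. *)
pose d := eps / (M * m + 1).
have Mm : 0 < M * m + 1 by rewrite ltr_pwDr// mulr_ge0.
have d0 : 0 < d by rewrite divr_gt0.
have deps : d * M * m < eps.
  rewrite -mulrA /d mulrAC ltr_pdivrMr// ltr_pM2l//; lra.
have KL p t : W t -> K (t ** p) -> L p.
  move=> Wt Kp; exists (inv t); first by exists t.
  by exists (t ** p) => //; rewrite gKg.
have eL : \forall t \near e, L `<=` [set p | `|phi (t ** p) - phi p| < d].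
  move/compact_near_coveringP: cL; apply => p _.
  exact: (near_mull_continuous HG).
have near_y0 : \forall y \near y0, W (y ** inv y0) /\
    L `<=` [set p | `|phi (y ** inv y0 ** p) - phi p| < d].
  have c1 : continuous (fun y => y ** inv y0).
    by apply: (continuous_mulg HG id) => ?; [|exact: cst_continuous].
  have := c1 y0; rewrite /continuous_at gV => /(_ _ (filterI eW eL)) WL.
  exact: WL.
apply: filterS near_y0 => y [Wy Ly].
have E z : y ** z = y ** inv y0 ** (y0 ** z) by rewrite gA (mulgKV HG).
have bound z : `|phi (y ** z) - phi (y0 ** z)| <= d * \1_L' z.
  rewrite indicE E; have [|] := boolP (z \in L').
    by rewrite inE /L' (ltransE HG) (invgK HG) mulr1 => /Ly/ltW.
  rewrite notin_setE /L' (ltransE HG) (invgK HG).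
  move=> nL; rewrite mulr0 phiK; last by move=> /(KL _ _ Wy).
  rewrite phiK ?subrr ?normr0// => Kz; apply: nL.
  by apply: (KL _ e); [exact: nbhs_singleton|rewrite (mul1g HG)].
have H1 := conv_le y y0 d L' (ltW d0) cL'.
have H2 := conv_le y0 y d L' (ltW d0) cL'.
have {H1} : (conv phi h y <= conv phi h y0 + (d * M * m)%:E)%E.
  by apply: H1 => z; have := bound z; rewrite ler_distl; lra.
have {H2} : (conv phi h y0 <= conv phi h y + (d * M * m)%:E)%E.
  by apply: H2 => z; have := bound z; rewrite ler_distl; lra.
rewrite -(fineK (conv_fin_num y)) -(fineK (conv_fin_num y0)) -!EFinD !lee_fin/=.
by rewrite ltr_distlC; lra.
Qed.

End Convolution.

End HaarMeasure.
Arguments conv {R G} mul inv mu.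

(** * Averaging over the hull *)

(** For a small symmetric [W], the sets a W with [a] in [x Lam] are disjoint by separation, and h(a)
    is at most [T] on a W. So h(a) times the measure of [W] is at most the integral of [T] over a W,
    and summing leaves a tail of the integral of [T], which does not depend on [x]. *)
Lemma amalgam_tail {R : realType} {G : ptopologicalType} {mul : G -> G -> G}
    {inv : G -> G} {e : G} {mu : {measure set (borel G) -> \bar R}}
    (HG : lcsc_group mul inv e) (Hmu : left_haar mul mu)
    (Q U Lam : set G) (h : G -> R) (T : borel G -> \bar R) (eps : R) :
  nbhs e Q -> open U -> U !=set0 -> lseparated mul U Lam ->
  (forall x, 0 <= h x) ->
  measurable_fun [set: borel G] T -> (forall x, 0 <= T x)%E ->
  (\int[mu]_(x in [set: borel G]) T x < +oo)%E ->
  (forall x q, Q q -> ((h (mul x q))%:E <= T x)%E) -> 0 < eps ->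
  exists2 K : set G, compact K & forall x,
    (\esum_(y in ltrans mul x Lam `&` ~` K) (h y)%:E <= eps%:E)%E.
Proof.
move=> eQ oU [u Uu] sL h0 mT T0 Toy hT eps0.
have [C cC eC] := compact_nbhs HG e.
have eU : nbhs e (ltrans mul (inv u) U).
  apply: open_nbhs_nbhs; split; first exact: (open_ltrans HG).
  by rewrite (ltransE HG) (invgK HG) (mulg1 HG).
have [W [oW We Wsym WP]] :=
  near_symmetric_root HG _ (filterI eQ (filterI eC eU)).
have WW w : W w -> [/\ Q w, C w & U (mul u w)].
  move=> Ww; have [+ [+ +]] := WP _ _ Ww We.
  by rewrite (mulg1 HG) (ltransE HG) (invgK HG).
have mW : measurable (W : set (borel G)) by exact: sub_sigma_algebra.
have muW : mu W \is a fin_num.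
  rewrite ge0_fin_numE//; apply: le_lt_trans (haar_compact_lty Hmu C cC).
  apply: le_measure; rewrite ?inE//; first exact: (compact_measurable_borel HG).
  by move=> w /WW[].
have m0 : 0 < fine (mu W).
  apply: fine_gt0; rewrite -ge0_fin_numE// muW andbT.
  by case: Hmu => _ _; apply => //; exists e.
have [K cK TK] := integral_compact_tail HG T (eps * fine (mu W)) mT T0 Toy
  (mulr_gt0 eps0 m0).
(* For [a] outside K C, the whole of a W avoids [K], since [W] is symmetric and contained in [C]. *)
exists [set mul k c | k in K & c in C]; first exact: (compact_mulset HG).
move=> x; apply: ge_ereal_sup => _ [X [fX XS] <-].
rewrite fsbig_finite//= sumEFin; set A := fset_set X.
have AX a : a \in A -> (ltrans mul x Lam `&` ~` [set mul k c | k in K & c in C]) a.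
  by rewrite in_fset_set// inE => /XS.
have mWa a : measurable (ltrans mul a W : set (borel G)).
  exact: (measurable_ltrans HG).
have tW : trivIset [set` A] (fun a => ltrans mul a W : set (borel G)).
  move=> a b aA bA [z [/= [w Ww awz] [v Wv bvz]]].
  apply: (separated_translate HG U Lam u x z) => //.
  - by have [] := AX _ aA.
  - by have [] := AX _ bA.
  - rewrite -(mulgK HG w a) awz (mulKg HG).
    by case: (WW _ (Wsym _ Ww)).
  - rewrite -(mulgK HG v b) bvz (mulKg HG).
    by case: (WW _ (Wsym _ Wv)).
have WK : \big[setU/set0]_(a <- A) (ltrans mul a W : set (borel G)) `<=` ~` K.
  rewrite -bigcup_fset => z [a aA [w Ww awz]] Kz.
  have [_] := AX _ aA; apply; exists z => //; exists (inv w).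
    by case: (WW _ (Wsym _ Ww)).
  by rewrite -awz (mulgK HG).
have mK : measurable (~` K : set (borel G)).
  by apply: measurableC; exact: (compact_measurable_borel HG).
suff : ((\sum_(a <- A) h a)%:E * mu W <= (eps * fine (mu W))%:E)%E.
  by rewrite -(fineK muW) -EFinM !lee_fin ler_pM2r.
apply: le_trans TK.
apply: (@le_trans _ _ (\int[mu]_(z in \big[setU/set0]_(a <- A)
    (ltrans mul a W : set (borel G))) T z)%E); last first.
  apply: ge0_subset_integral => //; first exact: bigsetU_measurable.
  exact: measurable_funTS.
rewrite ge0_integral_bigsetU//; last exact: measurable_funTS.
rewrite -sumEFin ge0_sume_distrl; last by move=> a _; rewrite lee_fin.
rewrite big_seq [leRHS]big_seq; apply: lee_sum => a aA.
have <- : mu (ltrans mul a W) = mu W by case: Hmu => inv_mu _ _; exact: inv_mu.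
rewrite -integral_cst//; apply: ge0_le_integral => //.
- by move=> z _; rewrite lee_fin.
- exact: measurable_funTS.
move=> z [w Ww <-]; rewrite -[in leLHS](mulgK HG w a); apply: hT.
by case: (WW _ (Wsym _ Ww)).
Qed.

(** * Haar integrals bounded through the covolume *)

Section Covolume.
Context {R : realType} {G : ptopologicalType} {mul : G -> G -> G} {inv : G -> G}
  {e : G} {mu : {measure set (borel G) -> \bar R}}.
Hypotheses (HG : lcsc_group mul inv e) (Hmu : left_haar mul mu).
Context {Lam : set G} {nu : {measure set (CFborel mul e) -> \bar R}} {covol : R}.
Hypothesis Hnu : inv_radon_prob_on_hull mul e Lam nu.
Hypothesis Hcovol : is_covol mul e mu nu covol.

Local Notation orbit_sum F Gam := (\esum_(y in Gam) (F y)%:E)%E.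

Let measurable_orbit (F : G -> R) := @measurable_orbit_sum _ _ _ _ _ HG F.

(** The covolume identity integrates over all sets, while the bounds hold on the hull; its
    complement is [nu]-null. *)
Let ae_hull (P : set G -> Prop) : (forall Gam, hull mul e Lam Gam -> P Gam) ->
  {ae nu, forall Gam : CFborel mul e, setT Gam -> P Gam}.
Proof.
move=> hP; exists (~` hull mul e Lam); split.
- by apply: measurableC; exact: (measurable_hull HG).
- by case: Hnu.
- by move=> Gam nP hGam; apply: nP => _; exact: hP.
Qed.

Let nu_cst (b : R) : (\int[nu]_(Gam in [set: CFborel mul e]) b%:E = b%:E)%E.
Proof. by rewrite integral_cst//; case: Hnu => -> *; rewrite mule1. Qed.

Lemma haar_integral_le_covol (F : G -> R) (b : R) : 0 <= b ->
  Cc F -> (forall x, 0 <= F x) ->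
  (forall x, (orbit_sum F (ltrans mul x Lam) <= b%:E)%E) ->
  (\int[mu]_(x in [set: borel G]) (F x)%:E <= (covol * b)%:E)%E.
Proof.
move=> b0 cF F0 Fb; have [c0 /(_ F cF F0) cE] := Hcovol.
rewrite mulrC EFinM -lee_pdivrMr// muleC -cE -(nu_cst b).
apply: ae_ge0_le_integral => //.
- by move=> Gam _; apply: esum_ge0 => y _; rewrite lee_fin.
- by apply: measurable_orbit => //; case: cF.
apply: ae_hull => Gam; apply: (hull_orbit_sum_le HG) => //.
by case: cF.
Qed.

Lemma haar_integral_ge_covol (F : G -> R) (U : set G) (b : R) : 0 <= b ->
  open U -> U !=set0 -> lseparated mul U Lam ->
  Cc F -> (forall x, 0 <= F x) ->
  (forall x, (b%:E <= orbit_sum F (ltrans mul x Lam))%E) ->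
  ((covol * b)%:E <= \int[mu]_(x in [set: borel G]) (F x)%:E)%E.
Proof.
move=> b0 oU U0 sL cF F0 Fb; have [c0 /(_ F cF F0) cE] := Hcovol.
rewrite mulrC EFinM -lee_pdivlMr// muleC -cE -(nu_cst b).
apply: ae_ge0_le_integral => //.
- by move=> Gam _; apply: esum_ge0 => y _; rewrite lee_fin.
- by apply: measurable_orbit => //; case: cF.
by apply: ae_hull => Gam; exact: (hull_orbit_sum_ge HG F U).
Qed.

(** A cutoff equal to 1 at [e] exceeds 1/2 on an open set, which has positive Haar measure.
    Positivity later allows division by the integral of [phi]. *)
Lemma Cc_bump : exists phi : G -> R, [/\ Cc phi, forall x, 0 <= phi x <= 1 &
  (0 < \int[mu]_(x in [set: borel G]) (phi x)%:E)%E].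
Proof.
have [phi [cphi phi01 phi1]] := compact_cutoff HG R [set e] (@compact_set1 _ e).
exists phi; split=> //.
pose V := phi @^-1` [set r | 1 / 2 < r].
have oV : open V.
  by apply: open_comp; [move=> y _; case: cphi => + _; exact|exact: open_gt].
have mV : measurable (V : set (borel G)) by exact: sub_sigma_algebra.
have muV : (0 < mu V)%E.
  by case: Hmu => _ _; apply => //; exists e; rewrite /V/= phi1//; lra.
have half0 : 0 <= 1 / 2 :> R by lra.
apply: (@lt_le_trans _ _
    (\int[mu]_(x in [set: borel G]) ((1 / 2)%:E * (\1_V x)%:E))%E).
  rewrite ge0_integralZl//; last by apply/measurable_EFinP; exact: measurable_indic.
  by rewrite integral_indic// setIT mule_gt0// lte_fin; lra.
apply: ge0_le_integral => //.
- by apply: measurable_funeM; apply/measurable_EFinP; exact: measurable_indic.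
- by apply/measurable_EFinP; apply: continuous_measurable_borel; case: cphi.
move=> x _; rewrite -EFinM lee_fin indicE; have [|_] := boolP (x \in V).
  by rewrite inE /V/= mulr1; lra.
by rewrite mulr0; case/andP: (phi01 x).
Qed.

(** * From continuous to bounded measurable functions *)

Section Smoothing.
Context (h : G -> R) (M b : R).
Hypotheses (mh : measurable_fun [set: borel G] (h : borel G -> R)).
Hypotheses (h0 : forall x, 0 <= h x) (hM : forall x, h x <= M).

Let smooth_data (phi : G -> R) (cphi : Cc phi) (phi01 : forall x, 0 <= phi x <= 1) :
  let k y := fine (conv mul inv mu phi h y) in
  [/\ continuous k, forall y, 0 <= k y,
    forall y, (k y)%:E = conv mul inv mu phi h y &
    (\int[mu]_(y in [set: borel G]) (k y)%:E =
     \int[mu]_(x in [set: borel G]) (phi x)%:E *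
     \int[mu]_(x in [set: borel G]) (h x)%:E)%E].
Proof.
move=> k.
have p0 x : 0 <= phi x by case/andP: (phi01 x).
have p1 x : phi x <= 1 by case/andP: (phi01 x).
have kE y : (k y)%:E = conv mul inv mu phi h y.
  by rewrite /k fineK//; exact: (conv_fin_num HG Hmu phi h M).
split=> //.
- exact: (continuous_conv HG Hmu phi h M).
- by move=> y; apply: fine_ge0; exact: conv_ge0.
- rewrite -(integral_conv HG Hmu phi h)//.
  by apply: eq_integral => y _; exact: kE.
Qed.

Let Cc_mull (k chi : G -> R) : continuous k -> Cc chi -> Cc (fun y => k y * chi y).
Proof.
move=> ck [cchi [K [cK Kchi]]]; split.
  by move=> y; apply: cvgM; [exact: ck|exact: cchi].
by exists K; split=> // y /Kchi ->; rewrite mulr0.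
Qed.

(** The sum of [k] over [x Lam] averages the sums of [h] over y^-1 x Lam, so it is at most [b] times
    the integral of [phi]; that integral cancels at the end. *)
Lemma haar_integral_le_orbit_sum : 0 <= b ->
  (forall x, (orbit_sum h (ltrans mul x Lam) <= b%:E)%E) ->
  (\int[mu]_(x in [set: borel G]) (h x)%:E <= (covol * b)%:E)%E.
Proof.
move=> b0 hb; have [phi [cphi phi01 Iphi]] := Cc_bump.
have p0 x : 0 <= phi x by case/andP: (phi01 x).
have p1 x : phi x <= 1 by case/andP: (phi01 x).
have := smooth_data phi cphi phi01; set k := fun y => fine _.
move=> [ck k0 kE Ik].
set I := (\int[mu]_(x in [set: borel G]) (phi x)%:E)%E in Iphi Ik.
have Ifin : I \is a fin_num.
  rewrite ge0_fin_numE ?(ltW Iphi)//; exact: (haar_integral_Cc_lty HG Hmu phi).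
have mphi : measurable_fun [set: borel G] (phi : borel G -> R).
  by apply: continuous_measurable_borel; case: cphi.
have mhr a : measurable_fun [set: borel G] (fun x : borel G => h (mul (inv x) a)).
  exact: (measurable_fun_mulVr HG h).
have ksum x : (orbit_sum k (ltrans mul x Lam) <= (fine I * b)%:E)%E.
  apply: ge_ereal_sup => _ [X [fX XS] <-]; rewrite fsbig_finite//=.
  rewrite (eq_bigr (conv mul inv mu phi h)) => [|y _]; last exact: kE.
  rewrite (sum_conv HG phi h)// EFinM fineK// /I -ge0_integralZr//; last 2 first.
  - exact/measurable_EFinP.
  - by move=> y _; rewrite lee_fin.
  apply: ge0_le_integral => //.
  - by move=> y _; rewrite lee_fin mulr_ge0// sumr_ge0.
  - apply/measurable_EFinP; apply: measurable_funM => //.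
    by apply: measurable_sum => a; exact: mhr.
  - by apply: emeasurable_funM => //; exact/measurable_EFinP.
  move=> y _; rewrite -EFinM lee_fin ler_wpM2l//.
  rewrite -lee_fin; apply: le_trans (hb (mul (inv y) x)).
  rewrite -sumEFin; apply: sum_fset_le_esum => //.
    by move=> u v _ _; exact: (mulgI HG).
  move=> a; rewrite in_fset_set// inE => /XS.
  by rewrite !(ltransE HG) (invMg HG) (invgK HG) -(mulgA HG) (mulKVg HG).
have Ik_le : (I * \int[mu]_(x in [set: borel G]) (h x)%:E <=
    (covol * (fine I * b))%:E)%E.
  rewrite -Ik; apply: (integral_le_compact HG) => //.
    by apply/measurable_EFinP; exact: continuous_measurable_borel.
  (* The cutoff makes [k * chi] compactly supported, keeps [k] unchanged on [K], and only decreases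
     the orbit sums. *)
  move=> K cK; have [chi [cchi chi01 chi1]] := compact_cutoff HG R K cK.
  have c0 x : 0 <= chi x by case/andP: (chi01 x).
  have mK := compact_measurable_borel HG K cK.
  have mF : measurable_fun [set: borel G] (fun x : borel G => (k x * chi x)%:E).
    apply/measurable_EFinP; apply: continuous_measurable_borel.
    by case: (Cc_mull k chi ck cchi).
  apply: (@le_trans _ _ (\int[mu]_(x in [set: borel G]) (k x * chi x)%:E)%E).
    apply: (@le_trans _ _ (\int[mu]_(x in (K : set (borel G))) (k x * chi x)%:E)%E).
      rewrite le_eqVlt; apply/orP; left; apply/eqP; apply: eq_integral => x.
      by rewrite inE => /chi1 ->; rewrite mulr1.
    apply: ge0_subset_integral => //.
    by move=> x _; rewrite lee_fin mulr_ge0.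
  apply: haar_integral_le_covol; first by rewrite mulr_ge0// fine_ge0// ltW.
  - exact: Cc_mull.
  - by move=> x; rewrite mulr_ge0.
  move=> x; apply: le_trans (ksum x); apply: le_esum => y _.
  by rewrite lee_fin ler_piMr//; case/andP: (chi01 y).
have I0 : 0 < fine I by rewrite fine_gt0// Iphi -ge0_fin_numE// ltW.
move: Ik_le; rewrite -(fineK Ifin) mulrCA EFinM lee_pmul2l//.
Qed.

(** As [k * chi] is at most [k], it suffices to bound its orbit sums below. The uniform tail
    hypothesis makes the loss due to [chi] arbitrarily small. *)
Lemma haar_integral_ge_orbit_sum (U : set G) : 0 <= b ->
  open U -> U !=set0 -> lseparated mul U Lam ->
  (forall x, (b%:E <= orbit_sum h (ltrans mul x Lam))%E) ->
  (forall eps, 0 < eps -> exists2 K : set G, compact K &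
    forall x, (orbit_sum h (ltrans mul x Lam `&` ~` K) <= eps%:E)%E) ->
  ((covol * b)%:E <= \int[mu]_(x in [set: borel G]) (h x)%:E)%E.
Proof.
move=> b0 oU U0 sL hb htail; have [phi [cphi phi01 Iphi]] := Cc_bump.
have p0 x : 0 <= phi x by case/andP: (phi01 x).
have p1 x : phi x <= 1 by case/andP: (phi01 x).
have := smooth_data phi cphi phi01; set k := fun y => fine _.
move=> [ck k0 kE Ik].
set I := (\int[mu]_(x in [set: borel G]) (phi x)%:E)%E in Iphi Ik.
have Ifin : I \is a fin_num.
  rewrite ge0_fin_numE ?(ltW Iphi)//; exact: (haar_integral_Cc_lty HG Hmu phi).
have I0 : 0 < fine I by rewrite fine_gt0// Iphi -ge0_fin_numE// ltW.
have mphi : measurable_fun [set: borel G] (phi : borel G -> R).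
  by apply: continuous_measurable_borel; case: cphi.
have mhr a : measurable_fun [set: borel G] (fun x : borel G => h (mul (inv x) a)).
  exact: (measurable_fun_mulVr HG h).
have [c0 _] := Hcovol.
apply/lee_subgt0Pr => eps eps0.
have d0 : 0 < eps / covol by rewrite divr_gt0.
(* A loss of [eps / covol] in the orbit sums costs [eps] in the integral; the maximum with 0
   provides the nonnegative bound that [haar_integral_ge_covol] asks for. *)
pose b' := Num.max 0 (b - eps / covol).
have b'0 : 0 <= b' by rewrite le_max lexx.
apply: (@le_trans _ _ (covol * b')%:E).
  rewrite -EFinB lee_fin -(divfK (lt0r_neq0 c0) eps) [_ / _ * _]mulrC -mulrBr.
  by rewrite ler_wpM2l ?(ltW c0)// le_max lexx orbT.
have [K1 cK1 K1tail] := htail _ d0.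
have [Kp [cKp Kphi]] := cphi.2.
(* Chosen so that y K1 lies in [K] for every [y] in [Kp], off which [phi] vanishes. *)
pose K := [set mul p q | p in Kp & q in K1].
have cK : compact K by exact: (compact_mulset HG).
have [chi [cchi chi01 chi1]] := compact_cutoff HG R K cK.
have chi0 x : 0 <= chi x by case/andP: (chi01 x).
have [N NP] := separated_card HG _ _ _ oU U0 sL cK.
suff H x : ((fine I * b')%:E <=
    orbit_sum (fun y => k y * chi y) (ltrans mul x Lam))%E.
  have := @haar_integral_ge_covol (fun y => k y * chi y) U (fine I * b')
    (mulr_ge0 (ltW I0) b'0) oU U0 sL (Cc_mull _ _ ck cchi)
    (fun y => mulr_ge0 (k0 y) (chi0 y)) H.
  move=> /le_trans-/(_ (\int[mu]_(y in [set: borel G]) (k y)%:E)%E) kchi.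
  rewrite -(@lee_pmul2l _ (fine I)%:E)// -EFinM mulrCA [leRHS](_ : _ =
    (\int[mu]_(y in [set: borel G]) (k y)%:E)%E); last by rewrite Ik fineK.
  apply: kchi; apply: ge0_le_integral => //.
  - by move=> y _; rewrite lee_fin mulr_ge0.
  - apply/measurable_EFinP; apply: continuous_measurable_borel.
    by case: (Cc_mull k chi ck cchi).
  - by apply/measurable_EFinP; exact: continuous_measurable_borel.
  - by move=> y _; rewrite lee_fin ler_piMr//; case/andP: (chi01 y).
pose S := ltrans mul x Lam `&` K.
have [|fS _] := NP x S _ (@subIsetr _ _ _); first by move=> ? [].
pose A := fset_set S.
apply: (@le_trans _ _ (\sum_(a <- A) (k a)%:E)%E); last first.
  apply: esum_ge; exists S; first by split=> // ? [].
  rewrite fsbig_finite//= -/A big_seq [leRHS]big_seq; apply: lee_sum => a.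
  by rewrite in_fset_set// inE => -[_ /chi1 ->]; rewrite mulr1.
rewrite (eq_bigr (conv mul inv mu phi h)) => [|y _]; last exact: kE.
rewrite (sum_conv HG phi h)// EFinM fineK// /I -ge0_integralZr//; last 2 first.
- exact/measurable_EFinP.
- by move=> y _; rewrite lee_fin.
apply: ge0_le_integral => //.
- by move=> y _; rewrite mule_ge0// lee_fin.
- by apply: emeasurable_funM => //; exact/measurable_EFinP.
- apply/measurable_EFinP; apply: measurable_funM => //.
  by apply: measurable_sum => a; exact: mhr.
move=> y _; rewrite -EFinM lee_fin.
have [Kpy|nKpy] := pselect (Kp y); last by rewrite (Kphi _ nKpy) !mul0r.
rewrite ler_wpM2l// ge_max sumr_ge0//= lerBlDr -lee_fin.
(* The part of y^-1 x Lam inside [K1] is contained in y^-1 A; the rest contributes at most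
   [eps / covol]. *)
apply: (le_trans (hb (mul (inv y) x))).
rewrite (esumID K1) => [|z _]; last by rewrite lee_fin.
rewrite EFinD; apply: leeD; last exact: K1tail.
set S1 := _ `&` K1.
have S1A z : S1 z -> mul y z \in A.
  move=> [Lz K1z]; rewrite in_fset_set// inE; split.
    by move: Lz; rewrite !(ltransE HG) (invMg HG) (invgK HG) (mulgA HG).
  by exists y => //; exists z.
rewrite (_ : (\sum_(a <- A) h (mul (inv y) a))%:E =
   (\esum_(a in [set` A]) (h (mul (inv y) a))%:E)%E); last first.
  rewrite esum_fset// ?fsbig_finite// ?set_fsetK ?sumEFin//.
  by move=> a _; rewrite lee_fin.
rewrite -(esum_image [set` A] (mul (inv y)) (fun z => (h z)%:E)); last first.
  by move=> u v _ _; exact: (mulgI HG).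
apply: ereal_sup_le => _ [X [fX XS] <-]; exists X => //; split=> // z /XS/S1A zA.
by exists (mul y z) => //; rewrite (mulKg HG).
Qed.

End Smoothing.
End Covolume.

(** * Coefficients of a projective representation *)

Section Hilbert.
Context {R : realType} {H : lmodType R[i]} {ip : H -> H -> R[i]}.
Hypothesis HH : is_hilbert ip.
Local Notation normc := ComplexField.Normc.normc.

Lemma ip_linear (a : R[i]) f g h : ip (a *: f + g) h = a * ip f h + ip g h.
Proof. by case: HH. Qed.

Lemma ip_conj f g : ip g f = conjc (ip f g).
Proof. by case: HH => _ ->. Qed.

Lemma Re_ip_ge0 f : 0 <= complex.Re (ip f f).
Proof. by case: HH => _ _ /(_ f)[]. Qed.

Lemma Im_ip f : complex.Im (ip f f) = 0.
Proof. by case: HH => _ _ /(_ f)[]. Qed.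

Lemma hnorm_ge0 f : 0 <= hnorm ip f.
Proof. exact: sqrtr_ge0. Qed.

Lemma sqr_hnorm f : hnorm ip f ^+ 2 = complex.Re (ip f f).
Proof. by rewrite sqr_sqrtr// Re_ip_ge0. Qed.

Lemma hnorm_gt0 f : f != 0 -> 0 < hnorm ip f.
Proof.
move=> f0; rewrite lt0r hnorm_ge0 andbT; apply: contra_neq f0 => f0.
have [_ _ _ ip0 _] := HH; apply: ip0; apply/eqP; rewrite eq_complex/= Im_ip.
by rewrite -sqr_hnorm f0 expr0n eqxx.
Qed.

Lemma normc_ge0 (z : R[i]) : 0 <= normc z.
Proof. by case: z => a b; exact: sqrtr_ge0. Qed.

Lemma sqr_normcE (z : R[i]) :
  normc z ^+ 2 = complex.Re z ^+ 2 + complex.Im z ^+ 2.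
Proof. by case: z => a b; rewrite sqr_sqrtr// addr_ge0 ?sqr_ge0. Qed.

Lemma normc_conj (z : R[i]) : normc (conjc z) = normc z.
Proof. by case: z => a b /=; rewrite sqrrN. Qed.

Lemma ip_scale_l (a : R[i]) f g : ip (a *: f) g = a * ip f g.
Proof.
have ip0 : ip 0 g = 0.
  by have := ip_linear (-1) 0 0 g; rewrite scaler0 addr0 mulN1r addNr.
by rewrite -[a *: f]addr0 ip_linear ip0 addr0.
Qed.

Lemma ip_scale_r (a : R[i]) f g : ip f (a *: g) = conjc a * ip f g.
Proof. by rewrite ip_conj ip_scale_l rmorphM/= -ip_conj.
Qed.

Lemma ipB f g h : ip h (f - g) = ip h f - ip h g.
Proof.
rewrite ip_conj addrC -scaleN1r ip_linear mulN1r rmorphD rmorphN/=.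
by rewrite -!ip_conj addrC.
Qed.

(** The Cauchy-Schwarz inequality. *)
Lemma normc_ip_le f g : normc (ip f g) <= hnorm ip f * hnorm ip g.
Proof.
have [->|g0] := eqVneq g 0.
  rewrite -(scale0r 0) ip_scale_r rmorph0 mul0r ComplexField.Normc.normc0.
  by rewrite mulr_ge0// hnorm_ge0.
rewrite -(@ler_pXn2r _ 2)// ?nnegrE ?mulr_ge0 ?hnorm_ge0 ?normc_ge0//.
rewrite exprMn !sqr_hnorm sqr_normcE.
have n0 : 0 < complex.Re (ip g g) by rewrite -sqr_hnorm exprn_gt0// hnorm_gt0.
have := Im_ip g; move: n0; case Egg : (ip g g) => [n n'] /= n0 n'0.
have := Im_ip f; case Eff : (ip f f) => [m m'] /= m'0.
case Efg : (ip f g) => [a b] /=.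
(* [w = |g|^2 f - <f,g> g] is orthogonal to [g]. *)
pose w := (ip g g) *: f + (- ip f g) *: g.
have Ew h : ip w h = ip g g * ip f h - ip f g * ip g h.
  by rewrite /w ip_linear ip_scale_l mulNr.
have wg : ip w g = 0 by rewrite Ew mulrC subrr.
(* By orthogonality [ip w w] is |g|^2 (|f|^2 |g|^2 - |<f,g>|^2), and the positive factor |g|^2 can
   be cancelled. *)
have := Re_ip_ge0 w; rewrite Ew [ip f w]ip_conj [ip g w]ip_conj wg rmorph0 mulr0.
rewrite subr0 Ew [ip g f]ip_conj Egg Eff Efg n'0 m'0 /=.
rewrite !(mul0r, mulr0, subr0, oppr0, addr0, mulrN, opprK, mulNr).
rewrite pmulr_rge0//; nra.
Qed.

(** Strong measurability concerns preimages of norm-open sets; by Cauchy-Schwarz the vectors with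
    |<f,v>| > a form such a set. *)
Lemma measurable_normc_ip d (T : measurableType d) (phi : T -> H) (f : H) :
  (forall U, hopen ip U -> measurable (phi @^-1` U)) ->
  measurable_fun [set: T] (fun t => normc (ip f (phi t))).
Proof.
move=> mphi; apply: (measurability _ (RGenOInfty.measurableE R)).
move=> _ [_ [a ->] <-]; rewrite setTI.
rewrite (_ : _ @^-1` _ = phi @^-1` [set v | a < normc (ip f v)]); last first.
  by apply/seteqP; split=> t; rewrite /preimage/= in_itv/= andbT.
apply: mphi => v /= av.
have f1 : 0 < hnorm ip f + 1 by rewrite ltr_wpDl ?hnorm_ge0.
(* The 1 covers the case where [f] has norm 0. *)
exists ((normc (ip f v) - a) / (hnorm ip f + 1)).
  by rewrite divr_gt0// subr_gt0.
move=> u; rewrite ltr_pdivlMr// => uv.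
have := le_normcD (ip f u) (- (ip f u - ip f v)).
rewrite normcN opprB addrCA subrr addr0 -ipB; have := normc_ip_le f (u - v).
have := hnorm_ge0 (u - v); lra.
Qed.

End Hilbert.

(** Take f' with pi(x) f' = f. Applying the isometry pi(x) to both arguments of <f', pi(l) psi>
    gives <f, pi(x l) psi> up to a phase, so frame bounds for [Lam] carry over to every [x Lam]. *)
Lemma frame_sum_ltrans {R : realType} {G : ptopologicalType} {mul : G -> G -> G}
    {e : G} {H : lmodType R[i]} {ip : H -> H -> R[i]} (pi : G -> H -> H)
    (HH : is_hilbert ip) (Hpi : proj_unitary_rep mul e ip pi)
    (Lam : set G) (psi f : H) (x : G) :
  exists2 f', hnorm ip f' = hnorm ip f &
    frame_sum ip pi Lam psi f' = (\esum_(l in Lam)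
      ((ComplexField.Normc.normc (voice ip pi psi f (mul x l))) ^+ 2)%:E)%E.
Proof.
have [upi _ _ [sigma [_ sigma1 pipi]]] := Hpi.
have [_ isom /(_ f)[f' <-]] := upi x; exists f'.
  by rewrite /hnorm isom.
apply: eq_esum => l _; congr (_%:E ^+ 2)%E; rewrite /voice.
rewrite -(isom f' (pi l psi)) pipi (ip_scale_r HH) ComplexField.Normc.normcM.
by rewrite normc_conj sigma1 mul1r.
Qed.

Theorem theorem3p5 (R : realType) (G : ptopologicalType)
  (mul : G -> G -> G) (inv : G -> G) (e : G) (HG : lcsc_group mul inv e)
  (mu : {measure set (borel G) -> \bar R}) (Hmu : left_haar mul mu)
  (H : lmodType R[i]) (ip : H -> H -> R[i]) (HH : is_hilbert ip)
  (pi : G -> H -> H) (Hpi : proj_unitary_rep mul e ip pi)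
  (Lam : set G) (HL : delone mul Lam)
  (nu : {measure set (CFborel mul e) -> \bar R})
  (Hnu : inv_radon_prob_on_hull mul e Lam nu)
  (covol : R) (Hcovol : is_covol mul e mu nu covol)
  (psi : H) :
  (forall C2 : R, 0 < C2 -> bessel ip pi Lam psi C2 ->
     forall f : H, f != 0 -> (coeff_ratio mu ip pi psi f covol <= C2%:E)%E) /\
  (forall (Q : set G) (C1 C2 : R), compact Q -> nbhs e Q ->
     B_space mul Q mu ip pi psi ->
     0 < C2 -> bessel ip pi Lam psi C2 ->
     0 < C1 -> lower_frame ip pi Lam psi C1 ->
     forall f : H, f != 0 -> (C1%:E <= coeff_ratio mu ip pi psi f covol)%E).
Proof.
pose h f x := ComplexField.Normc.normc (voice ip pi psi f x) ^+ 2.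
have [upi mpi _ _] := Hpi; have [c0 _] := Hcovol.
have h0 f x : 0 <= h f x by exact: sqr_ge0.
have hM f x : h f x <= (hnorm ip f * hnorm ip psi) ^+ 2.
  rewrite ler_pXn2r// ?nnegrE ?normc_ge0 ?mulr_ge0 ?hnorm_ge0//.
  have [_ isom _] := upi x; rewrite {2}/hnorm -(isom psi psi).
  exact: normc_ip_le.
have mh f : measurable_fun [set: borel G] (h f : borel G -> R).
  by apply: measurable_funX; apply: (measurable_normc_ip HH); exact: mpi.
have hsum f x : exists2 f', hnorm ip f' = hnorm ip f &
    frame_sum ip pi Lam psi f' =
      (\esum_(y in ltrans mul x Lam) (h f y)%:E)%E.
  have [f' f'f fsum] := frame_sum_ltrans pi HH Hpi Lam psi f x.
  by exists f' => //; rewrite (esum_ltrans HG).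
have fgt0 f : f != 0 -> 0 < hnorm ip f ^+ 2 * covol.
  by move=> fn0; rewrite mulr_gt0// exprn_gt0// (hnorm_gt0 HH).
have C0 (C : R) f : 0 < C -> 0 <= C * hnorm ip f ^+ 2.
  by move=> C0; rewrite mulr_ge0 ?sqr_ge0// ltW.
have CE (C : R) f : (C%:E * (hnorm ip f ^+ 2 * covol)%:E =
    (covol * (C * hnorm ip f ^+ 2))%:E)%E.
  by rewrite -EFinM; congr EFin; ring.
split=> [C2 C20 bes f fn0|Q C1 C2 _ eQ Bpsi _ _ C10 low f fn0].
  rewrite /coeff_ratio lee_pdivrMr ?fgt0// CE.
  apply: (haar_integral_le_orbit_sum HG Hmu Hnu Hcovol
    (h f) _ _ (mh f) (h0 f) (hM f)).
    exact: C0.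
  by move=> x; have [f' <- <-] := hsum f x; exact: bes.
have [[U [oU U0 sL]] _] := HL.
rewrite /coeff_ratio lee_pdivlMr ?fgt0// CE.
apply: (haar_integral_ge_orbit_sum HG Hmu Hnu Hcovol
  (h f) _ _ (mh f) (h0 f) (hM f) U) => //.
- exact: C0.
- by move=> x; have [f' <- <-] := hsum f x; exact: low.
have [_ mmax maxy] := Bpsi f.
(* The square of the maximal function is integrable because [psi] is in the space [B_space], and it
   dominates h(x q) for all [q] in [Q]. *)
pose T x := (maxfun mul Q (voice ip pi psi f) x ^+ 2)%E.
(* The supremum runs over a nonempty set, hence is nonnegative, as needed to square inequalities. *)
have Qe : Q e by exact: nbhs_singleton.
have le_max x q : Q q -> ((ComplexField.Normc.normc
    (voice ip pi psi f (mul x q)))%:E <= maxfun mul Q (voice ip pi psi f) x)%E.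
  by move=> Qq; apply: ereal_sup_ubound; exists q.
have max0 x : (0 <= maxfun mul Q (voice ip pi psi f) x)%E.
  by apply: le_trans (le_max x e Qe); rewrite lee_fin normc_ge0.
move=> eps eps0; apply: (amalgam_tail HG Hmu Q U Lam (h f) T) => //.
- by rewrite /T; under eq_fun do rewrite expe2; exact: emeasurable_funM.
- by move=> x; exact: expe_ge0.
- move=> x q Qq; rewrite /h EFin_expe lee_sqr ?le_max ?max0//.
  by rewrite lee_fin normc_ge0.
Qed.
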